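(* There is a right action of $\mathrm{SL}(2,\mathbb{R})$ on $\mathcal{D}^\infty\times C^\infty(\mathbb{S}^1)$, the domain of $\mathcal{E}_S$, and there are a right action and a left action of $\mathrm{SL}(2,\mathbb{R})$ on $\mathcal{D}^\infty_+$, the domain of $\mathcal{E}_G$ and $\mathcal{E}_G^*$ (namely the actions $(\sigma,f)\cdot A$, $\sigma\cdot A$ and $A\cdot\sigma$ described in the context), such that for every $A\in\mathrm{SL}(2,\mathbb{R})$: $$\mathcal{E}_S[(\sigma,f)\cdot A]=\mathcal{E}_S[\sigma,f]\quad\text{for all }\sigma\in\mathcal{D}^\infty,\ f\in C^\infty(\mathbb{S}^1),$$ $$\mathcal{E}_G[\sigma\cdot A]=\mathcal{E}_G[\sigma]\quad\text{and}\quad \mathcal{E}_G^*[A\cdot\sigma]=\mathcal{E}_G^*[\sigma]\quad\text{for all }\sigma\in\mathcal{D}^\infty_+ .$$ Furthermore, there is an involution $*:\mathcal{D}^\infty_+\to\mathcal{D}^\infty_+$ (namely the duality $\sigma\mapsto *\sigma=\sigma^*$ described in the context) such that for all $\sigma\in\mathcal{D}_+^\infty$ and $A\in\mathrm{SL}(2,\mathbb{R})$ $$*(A\cdot\sigma)=( *\sigma)\cdot A^{-1}\quad\text{and}\quad \mathcal{E}_G[*\sigma]=\frac{L(\sigma)}{2\pi}\,\mathcal{E}_G^*[\sigma].$$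
   Context: $\mathbb{S}^1\subset\mathbb{R}^2$ is the unit circle with its standard orientation, $\theta$ is the angular coordinate with $\theta(\mathbf{e}_1)=0$, and $\pi:\mathbb{R}\to\mathbb{S}^1$, $\pi(x)=(\cos x,\sin x)$. For an orientation preserving $C^1$ diffeomorphism $\varphi$ of $\mathbb{S}^1$, $\varphi'>0$ is defined by $\varphi^*\mathrm{d}\theta=\varphi'\,\mathrm{d}\theta$. A smooth degree-one curve is an immersion $\sigma:[0,2\pi]\to\mathbb{R}^2$ of the form $\sigma(t)=\mathbf{x}_\sigma+\frac{L(\sigma)}{2\pi}\int_0^t \mathbf{T}_\sigma(\pi(x))\,\mathrm{d}x$, where $\mathbf{T}_\sigma:\mathbb{S}^1\to\mathbb{S}^1$ (the unit tangent map) is a smooth map of degree one, $\mathbf{x}_\sigma\in\mathbb{R}^2$ is the base point and $L(\sigma)>0$ is the length; $\sigma$ is uniquely determined by $(\mathbf{T}_\sigma,\mathbf{x}_\sigma,L(\sigma))$ and need not be closed. It is strictly convex if $\mathbf{T}_\sigma$ has a smooth inverse. $\mathcal{D}^\infty$ (resp. $\mathcal{D}^\infty_+$) is the set of smooth (resp. smooth strictly convex) degree-one curves. With $\mathbf{T}_0(p)=-\sin(\theta(p))\mathbf{e}_1+\cos(\theta(p))\mathbf{e}_2$, the induced diffeomorphism of $\sigma\in\mathcal{D}^\infty_+$ is $\phi_\sigma=\mathbf{T}_0^{-1}\circ\mathbf{T}_\sigma$. The length element is $\mathrm{d}s=\frac{L(\sigma)}{2\pi}\mathrm{d}\theta$;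 the geodesic curvature $\kappa_\sigma$, regarded as a function on $\mathbb{S}^1$, is determined by $\mathbf{T}_\sigma^*\mathrm{d}\theta=\frac{L(\sigma)}{2\pi}\kappa_\sigma\,\mathrm{d}\theta$; $\nabla_\sigma$ is the intrinsic (arclength) gradient, so $|\nabla_\sigma f|=\frac{2\pi}{L(\sigma)}|\partial_\theta f|$. Integrals over $\sigma$ are integrals over $\mathbb{S}^1$ against $\mathrm{d}s$. The functionals are $$\mathcal{E}_S[\sigma,f]= \int_{\sigma} |\nabla_\sigma f|^2 +\kappa^2_\sigma f^2 -\frac{(2\pi)^2}{L(\sigma)^2} f^2\, \mathrm{d}s\qquad(\sigma\in\mathcal{D}^\infty,\ f\in C^\infty(\mathbb{S}^1)),$$ $$\mathcal{E}_G[\sigma]=\int_{\sigma} \frac{|\nabla_\sigma \kappa_\sigma|^2}{4 \kappa^3_\sigma} - \frac{(2\pi)^2}{L(\sigma)^2}\frac{1}{ \kappa_\sigma} \, \mathrm{d}s + 2\pi,\qquad \mathcal{E}_G^*[\sigma]=\int_{\sigma} \frac{|\nabla_\sigma \kappa_\sigma|^2}{4 \kappa^2_\sigma}-\kappa^2_\sigma \, \mathrm{d}s + \frac{(2\pi)^2}{L(\sigma)}\qquad(\sigma\in\mathcal{D}^\infty_+).$$ For $A\in\mathrm{SL}(2,\mathbb{R})$ let $\Gamma(A)(\mathbf{x})=\frac{A\mathbf{x}}{|A\mathbf{x}|}$, a diffeomorphism of $\mathbb{S}^1$. Actions: (i) for $\sigma\in\mathcal{D}^\infty$, $\sigma\cdot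 A$ is the curve with unit tangent map $\mathbf{T}_\sigma\circ\Gamma(A)$, base point $\mathbf{x}_\sigma$ and length $L(\sigma)$ (this preserves $\mathcal{D}^\infty_+$, where $\phi_{\sigma\cdot A}=\phi_\sigma\circ\Gamma(A)$); (ii) for $f\in C^\infty(\mathbb{S}^1)$, $f\cdot A=(\Gamma(A)')^{-1/2}\,f\circ\Gamma(A)$, and $(\sigma,f)\cdot A=(\sigma\cdot A,f\cdot A)$; (iii) for $\sigma\in\mathcal{D}^\infty_+$, $A\cdot\sigma$ is the curve with induced diffeomorphism $\Gamma(A)\circ\phi_\sigma$, base point $\mathbf{x}_\sigma$ and length $L(\sigma)$. Duality: for $\sigma\in\mathcal{D}^\infty_+$, $\sigma^*=*\sigma$ is the curve with induced diffeomorphism $\phi_\sigma^{-1}$, base point $\mathbf{x}_\sigma$ and length $L(\sigma)$. *)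

(* Defs.v *)
From Stdlib Require Export Reals Lra.
From Stdlib Require Import ClassicalEpsilon FunctionalExtensionality ProofIrrelevance.
From Coquelicot Require Export Coquelicot.
Open Scope R_scope.

(** * The circle *)

Record S1 := mkS1 { s1x : R; s1y : R; s1_unit : s1x ^ 2 + s1y ^ 2 = 1 }.

Lemma S1_ext (p q : S1) : s1x p = s1x q -> s1y p = s1y q -> p = q.
Proof.
destruct p as [a b h], q as [c d k]; simpl; intros -> ->.
f_equal; apply proof_irrelevance.
Qed.

Lemma circ_unit (x : R) : cos x ^ 2 + sin x ^ 2 = 1.
Proof. rewrite <- (sin2_cos2 x); unfold Rsqr; ring. Qed.

(** The covering map [pi] of the circle by the line. *)
Definition circ (x : R) : S1 := mkS1 (cos x) (sin x) (circ_unit x).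

(** The branch of the angular coordinate with values in (-PI, PI].  Everything
    below depends on the angle only modulo [2 * PI]. *)
Definition theta (p : S1) : R :=
  if Rle_dec 0 (s1y p) then acos (s1x p) else - acos (s1x p).

Lemma circ_theta (p : S1) : circ (theta p) = p.
Proof.
destruct p as [a b h].
assert (Ha : -1 <= a <= 1) by (split; nra).
assert (Hs : sin (acos a) = Rabs b).
{ rewrite sin_acos by exact Ha. rewrite <- sqrt_Rsqr_abs.
  f_equal. unfold Rsqr. lra. }
apply S1_ext; unfold theta; simpl; destruct (Rle_dec 0 b) as [hb | hb].
- now apply cos_acos.
- rewrite cos_neg; now apply cos_acos.
- rewrite Hs; now apply Rabs_pos_eq.
- rewrite sin_neg, Hs, Rabs_left; lra.
Qed.

(** Since [circ] is a local diffeomorphism, smoothness on the circle is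
    smoothness after composition with it; a map into the circle is smooth when
    it is smooth as a map into the plane. *)
Definition smooth_fun (f : S1 -> R) : Prop :=
  forall (n : nat) (x : R), ex_derive_n (fun t => f (circ t)) n x.

Definition smooth_map (F : S1 -> S1) : Prop :=
  smooth_fun (fun p => s1x (F p)) /\ smooth_fun (fun p => s1y (F p)).

Definition has_degree (F : S1 -> S1) (d : Z) : Prop :=
  exists g : R -> R,
    (forall x, continuous g x) /\
    (forall x, F (circ x) = circ (g x)) /\
    (forall x, g (x + 2 * PI) = g x + IZR d * (2 * PI)).

Definition dtheta (f : S1 -> R) (p : S1) : R :=
  Derive (fun t => f (circ t)) (theta p).

(** The coefficient [F'] in [F^* dtheta = F' dtheta], computed from
    [dtheta = x dy - y dx] on the circle. *)
Definition pullback (F : S1 -> S1) (p : S1) : R :=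
  s1x (F p) * dtheta (fun q => s1y (F q)) p
  - s1y (F p) * dtheta (fun q => s1x (F q)) p.

(** The inverse of a bijection of the circle (arbitrary on other maps). *)
Definition inverse (F : S1 -> S1) (q : S1) : S1 :=
  epsilon (inhabits (circ 0)) (fun p => F p = q).

(** * SL(2,R) and its action on the circle *)

(** The matrix with rows (m11, m12) and (m21, m22). *)
Record SL2 := mkSL2 {
  m11 : R; m12 : R; m21 : R; m22 : R;
  SL2_det : m11 * m22 - m12 * m21 = 1 }.

Lemma SL2_one_det : 1 * 1 - 0 * 0 = 1.
Proof. ring. Qed.

Definition SL2_one : SL2 := mkSL2 1 0 0 1 SL2_one_det.

Lemma SL2_mul_det (A B : SL2) :
  (m11 A * m11 B + m12 A * m21 B) * (m21 A * m12 B + m22 A * m22 B)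
  - (m11 A * m12 B + m12 A * m22 B) * (m21 A * m11 B + m22 A * m21 B) = 1.
Proof.
transitivity ((m11 A * m22 A - m12 A * m21 A) * (m11 B * m22 B - m12 B * m21 B)).
- ring.
- rewrite !SL2_det; ring.
Qed.

Definition SL2_mul (A B : SL2) : SL2 :=
  mkSL2 (m11 A * m11 B + m12 A * m21 B) (m11 A * m12 B + m12 A * m22 B)
        (m21 A * m11 B + m22 A * m21 B) (m21 A * m12 B + m22 A * m22 B)
        (SL2_mul_det A B).

Lemma SL2_inv_det (A : SL2) : m22 A * m11 A - (- m12 A) * (- m21 A) = 1.
Proof. rewrite <- (SL2_det A); ring. Qed.

Definition SL2_inv (A : SL2) : SL2 :=
  mkSL2 (m22 A) (- m12 A) (- m21 A) (m11 A) (SL2_inv_det A).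

Definition applyx (A : SL2) (p : S1) : R := m11 A * s1x p + m12 A * s1y p.
Definition applyy (A : SL2) (p : S1) : R := m21 A * s1x p + m22 A * s1y p.
Definition apply_norm (A : SL2) (p : S1) : R :=
  sqrt (applyx A p ^ 2 + applyy A p ^ 2).

Lemma Gamma_unit (A : SL2) (p : S1) :
  (applyx A p / apply_norm A p) ^ 2 + (applyy A p / apply_norm A p) ^ 2 = 1.
Proof.
assert (Hx : s1x p = m22 A * applyx A p - m12 A * applyy A p).
{ unfold applyx, applyy.
  transitivity ((m11 A * m22 A - m12 A * m21 A) * s1x p); [|ring].
  rewrite SL2_det; ring. }
assert (Hy : s1y p = m11 A * applyy A p - m21 A * applyx A p).
{ unfold applyx, applyy.
  transitivity ((m11 A * m22 A - m12 A * m21 A) * s1y p); [|ring].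
  rewrite SL2_det; ring. }
pose proof (s1_unit p) as Hp.
assert (Hpos : 0 < applyx A p ^ 2 + applyy A p ^ 2).
{ destruct (Rle_lt_or_eq_dec 0 (applyx A p ^ 2 + applyy A p ^ 2)) as [h | h];
    [nra | exact h |].
  assert (H1 : applyx A p = 0) by nra.
  assert (H2 : applyy A p = 0) by nra.
  rewrite H1, H2 in Hx, Hy. rewrite Hx, Hy in Hp. nra. }
assert (Hn : apply_norm A p ^ 2 = applyx A p ^ 2 + applyy A p ^ 2).
{ unfold apply_norm; rewrite pow2_sqrt; [reflexivity | lra]. }
assert (Hn0 : apply_norm A p <> 0).
{ intros h; rewrite h in Hn; lra. }
transitivity ((applyx A p ^ 2 + applyy A p ^ 2) / apply_norm A p ^ 2).
- field; exact Hn0.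
- rewrite <- Hn; field; exact Hn0.
Qed.

Definition Gamma (A : SL2) (p : S1) : S1 :=
  mkS1 (applyx A p / apply_norm A p) (applyy A p / apply_norm A p)
       (Gamma_unit A p).

(** Actions of SL(2,R) on the subset [D] of [X]. *)
Definition right_action {X : Type} (D : X -> Prop) (act : X -> SL2 -> X) : Prop :=
  (forall x A, D x -> D (act x A)) /\
  (forall x, D x -> act x SL2_one = x) /\
  (forall x A B, D x -> act (act x A) B = act x (SL2_mul A B)).

Definition left_action {X : Type} (D : X -> Prop) (act : SL2 -> X -> X) : Prop :=
  (forall A x, D x -> D (act A x)) /\
  (forall x, D x -> act SL2_one x = x) /\
  (forall A B x, D x -> act A (act B x) = act (SL2_mul A B) x).

Definition involution_on {X : Type} (D : X -> Prop) (s : X -> X) : Prop :=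
  (forall x, D x -> D (s x)) /\ (forall x, D x -> s (s x) = x).

(** * Degree-one curves *)

(** A curve is encoded by its unit tangent map, base point and length;
    [curve_map] is the parametrized curve itself on [0, 2 * PI], and
    [curve_map_inj] shows that the encoding loses nothing.  It is an immersion
    because its velocity has norm [len s / (2 * PI)], positive under [Dinf]. *)
Record curve := mkCurve {
  tangent : S1 -> S1;
  base : R * R;
  len : R }.

Definition curve_map (s : curve) (t : R) : R * R :=
  (fst (base s) + len s / (2 * PI) * RInt (fun x => s1x (tangent s (circ x))) 0 t,
   snd (base s) + len s / (2 * PI) * RInt (fun x => s1y (tangent s (circ x))) 0 t).

Definition Dinf (s : curve) : Prop :=
  smooth_map (tangent s) /\ has_degree (tangent s) 1 /\ 0 < len s.

Lemma Dinf_continuous (s : curve) (x : R) :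
  Dinf s ->
  continuous (fun t => s1x (tangent s (circ t))) x /\
  continuous (fun t => s1y (tangent s (circ t))) x.
Proof.
intros [[hx hy] _]; split;
  [exact (ex_derive_continuous _ _ (hx 1%nat x))
  |exact (ex_derive_continuous _ _ (hy 1%nat x))].
Qed.

(* The integrals determine a continuous integrand: differentiate from the
   right at a point of [0, 2 * PI). *)
Lemma primitive_inj (f g : R -> R) (a : R) :
  (forall x, continuous f x) -> (forall x, continuous g x) -> 0 < a ->
  (forall t, 0 <= t <= a -> RInt f 0 t = RInt g 0 t) ->
  forall t, 0 <= t < a -> f t = g t.
Proof.
intros Hf Hg Ha H t Ht.
set (h := fun x => f x - g x).
assert (Ch : forall x, continuous h x).
{ intros x; apply (continuous_minus f g); auto. }
assert (Ih : forall u, 0 <= u <= a -> RInt h 0 u = 0).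
{ intros u Hu; unfold h.
  pose proof (RInt_minus f g 0 u
    (ex_RInt_continuous f 0 u (fun z _ => Hf z))
    (ex_RInt_continuous g 0 u (fun z _ => Hg z))) as E.
  unfold minus, plus, opp in E; simpl in E.
  unfold Rminus; rewrite E, (H u Hu); apply Rplus_opp_r. }
assert (D : is_derive (fun u => RInt h 0 u) t (h t)).
{ apply (is_derive_RInt h _ 0); [|apply Ch].
  apply filter_forall; intros u; apply (RInt_correct h).
  apply (ex_RInt_continuous h); intros; apply Ch. }
apply is_derive_Reals in D.
enough (h t = 0) by (unfold h in *; lra).
destruct (Req_dec (h t) 0) as [E | N]; [exact E | exfalso].
destruct (D (Rabs (h t)) (Rabs_pos_lt _ N)) as [d Hd].
pose proof (cond_pos d) as dpos.
set (e := Rmin (d / 2) (a - t)).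
assert (He : 0 < e) by (unfold e; apply Rmin_pos; lra).
assert (He1 : e <= d / 2) by apply Rmin_l.
assert (He2 : e <= a - t) by apply Rmin_r.
specialize (Hd e).
rewrite !Ih in Hd by lra.
assert (X : Rabs ((0 - 0) / e - h t) < Rabs (h t)).
{ apply Hd; [lra | rewrite Rabs_pos_eq; lra]. }
replace ((0 - 0) / e - h t) with (- h t) in X by (field; lra).
rewrite Rabs_Ropp in X; lra.
Qed.

Lemma curve_map_inj (s r : curve) :
  Dinf s -> Dinf r ->
  (forall t, 0 <= t <= 2 * PI -> curve_map s t = curve_map r t) -> s = r.
Proof.
intros Ds Dr H.
pose proof PI_RGT_0 as Hpi.
assert (Cs := fun x => Dinf_continuous s x Ds).
assert (Cr := fun x => Dinf_continuous r x Dr).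
assert (Ls : 0 < len s) by apply Ds.
assert (Lr : 0 < len r) by apply Dr.
assert (HB : base s = base r).
{ specialize (H 0 ltac:(lra)); unfold curve_map in H.
  rewrite !RInt_point in H; unfold zero in H; simpl in H.
  injection H as H1 H2; rewrite !Rmult_0_r, !Rplus_0_r in H1, H2.
  now apply injective_projections. }
assert (key : forall u : S1 -> R,
  (forall x, continuous (fun t => u (tangent s (circ t))) x) ->
  (forall x, continuous (fun t => u (tangent r (circ t))) x) ->
  (forall t, 0 <= t <= 2 * PI ->
     len s / (2 * PI) * RInt (fun x => u (tangent s (circ x))) 0 t
     = len r / (2 * PI) * RInt (fun x => u (tangent r (circ x))) 0 t) ->
  forall p, len s * u (tangent s p) = len r * u (tangent r p)).
{ intros u Us Ur E p.
  assert (P : forall t, 0 <= t < 2 * PI ->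
    len s * u (tangent s (circ t)) = len r * u (tangent r (circ t))).
  { apply (primitive_inj (fun t => len s * u (tangent s (circ t)))
                         (fun t => len r * u (tangent r (circ t)))).
    - intros x; apply (continuous_scal_r (len s) _ x (Us x)).
    - intros x; apply (continuous_scal_r (len r) _ x (Ur x)).
    - lra.
    - intros t Ht.
      pose proof (RInt_scal (fun x => u (tangent s (circ x))) 0 t (len s)
        (ex_RInt_continuous _ 0 t (fun z _ => Us z))) as E1.
      pose proof (RInt_scal (fun x => u (tangent r (circ x))) 0 t (len r)
        (ex_RInt_continuous _ 0 t (fun z _ => Ur z))) as E2.
      unfold scal in E1, E2; simpl in E1, E2; unfold mult in E1, E2; simpl in E1, E2.
      rewrite E1, E2.
      specialize (E t Ht).
      apply (f_equal (Rmult (2 * PI))) in E.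
      field_simplify in E; lra. }
  rewrite <- (circ_theta p).
  assert (-PI <= theta p <= PI).
  { unfold theta; pose proof (acos_bound (s1x p)).
    destruct (Rle_dec 0 (s1y p)); lra. }
  destruct (Rle_dec 0 (theta p)).
  - apply P; lra.
  - replace (circ (theta p)) with (circ (theta p + 2 * PI)).
    + apply P; lra.
    + apply S1_ext; simpl; rewrite ?cos_plus, ?sin_plus, ?cos_2PI, ?sin_2PI; ring. }
assert (Kx := key s1x (fun x => proj1 (Cs x)) (fun x => proj1 (Cr x))).
assert (Ky := key s1y (fun x => proj2 (Cs x)) (fun x => proj2 (Cr x))).
assert (X : forall p, len s * s1x (tangent s p) = len r * s1x (tangent r p)).
{ apply Kx; intros t Ht; specialize (H t Ht); unfold curve_map in H.
  injection H as H1 _; rewrite HB in H1; lra. }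
assert (Y : forall p, len s * s1y (tangent s p) = len r * s1y (tangent r p)).
{ apply Ky; intros t Ht; specialize (H t Ht); unfold curve_map in H.
  injection H as _ H2; rewrite HB in H2; lra. }
assert (HL : len s = len r).
{ pose proof (s1_unit (tangent s (circ 0))).
  pose proof (s1_unit (tangent r (circ 0))).
  specialize (X (circ 0)); specialize (Y (circ 0)).
  assert (len s ^ 2 = len r ^ 2).
  { transitivity ((len s * s1x (tangent s (circ 0))) ^ 2
                  + (len s * s1y (tangent s (circ 0))) ^ 2).
    - transitivity (len s ^ 2 * 1); [ring | rewrite <- H0; ring].
    - rewrite X, Y; transitivity (len r ^ 2 * 1); [rewrite <- H1; ring | ring]. }
  nra. }
assert (HT : tangent s = tangent r).
{ apply functional_extensionality; intros p; rewrite HL in X, Y.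
  apply S1_ext; apply (Rmult_eq_reg_l (len r)); auto; lra. }
destruct s, r; simpl in *; subst; reflexivity.
Qed.

Definition strictly_convex (s : curve) : Prop :=
  exists S : S1 -> S1,
    smooth_map S /\
    (forall p, S (tangent s p) = p) /\ (forall p, tangent s (S p) = p).

Definition Dinf_plus (s : curve) : Prop := Dinf s /\ strictly_convex s.

Definition Dinf_fun (sf : curve * (S1 -> R)) : Prop :=
  Dinf (fst sf) /\ smooth_fun (snd sf).

Lemma T0_unit (p : S1) : (- sin (theta p)) ^ 2 + cos (theta p) ^ 2 = 1.
Proof. rewrite <- (circ_unit (theta p)); ring. Qed.

Definition T0 (p : S1) : S1 := mkS1 (- sin (theta p)) (cos (theta p)) (T0_unit p).

Definition induced (s : curve) (p : S1) : S1 := inverse T0 (tangent s p).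

(** The curve with given induced diffeomorphism, base point and length. *)
Definition of_induced (phi : S1 -> S1) (x : R * R) (l : R) : curve :=
  mkCurve (fun p => T0 (phi p)) x l.

(** * Functionals *)

Definition kappa (s : curve) (p : S1) : R :=
  2 * PI / len s * pullback (tangent s) p.

Definition grad_norm (s : curve) (f : S1 -> R) (p : S1) : R :=
  2 * PI / len s * Rabs (dtheta f p).

Definition int_curve (s : curve) (F : S1 -> R) : R :=
  RInt (fun x => F (circ x) * (len s / (2 * PI))) 0 (2 * PI).

Definition E_S (s : curve) (f : S1 -> R) : R :=
  int_curve s (fun p =>
    grad_norm s f p ^ 2 + kappa s p ^ 2 * f p ^ 2
    - (2 * PI) ^ 2 / len s ^ 2 * f p ^ 2).

Definition E_G (s : curve) : R :=
  int_curve s (fun p =>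
    grad_norm s (kappa s) p ^ 2 / (4 * kappa s p ^ 3)
    - (2 * PI) ^ 2 / len s ^ 2 * (1 / kappa s p))
  + 2 * PI.

Definition E_G_star (s : curve) : R :=
  int_curve s (fun p =>
    grad_norm s (kappa s) p ^ 2 / (4 * kappa s p ^ 2) - kappa s p ^ 2)
  + (2 * PI) ^ 2 / len s.

(** * Actions and duality *)

Definition curve_ract (s : curve) (A : SL2) : curve :=
  mkCurve (fun p => tangent s (Gamma A p)) (base s) (len s).

Definition fun_ract (f : S1 -> R) (A : SL2) : S1 -> R :=
  fun p => / sqrt (pullback (Gamma A) p) * f (Gamma A p).

Definition pair_ract (sf : curve * (S1 -> R)) (A : SL2) : curve * (S1 -> R) :=
  (curve_ract (fst sf) A, fun_ract (snd sf) A).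

Definition curve_lact (A : SL2) (s : curve) : curve :=
  of_induced (fun p => Gamma A (induced s p)) (base s) (len s).

Definition dual (s : curve) : curve :=
  of_induced (inverse (induced s)) (base s) (len s).

(* Main.v *)
Require Import Defs.
From Stdlib Require Import FunctionalExtensionality ProofIrrelevance ClassicalEpsilon.
From Stdlib Require Import Lia.

(** Everything is computed on lifts to the line of circle maps of degree one.  The
    lift [g] of [Gamma A] satisfies [g' = / q] with [q = |A p|^2], and
    [2 q q'' - q'^2 + 4 q^2 = 4] (the Schwarzian equation of a projective map);
    hence the integrand of [E_S] for the transformed pair is [g'] times the old
    integrand at [g], plus the derivative of the periodic function
    [(q' / 2) (F o g)^2], and [E_S] is invariant.
    [E_G s] is [len s / (2 * PI)] times [E_S] evaluated at the function
    [T' ^ (-1/2)], where [T] is the unit tangent map, and the right action carries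
    this function to the one of the transformed curve; so [E_G] is invariant too.
    The substitution by the inverse lift gives [E_G (dual s)] in terms of
    [E_G_star s], and the invariance of [E_G_star] follows since duality
    exchanges the two actions. *)

(** * Smooth functions on the line *)

(** Derivatives enter as witnesses, so that the closure lemmas below are inductions on [n] with
    explicit derivative formulas. The last derivative may be discontinuous, which is harmless since
    [smooth] asks for every [n]. *)
Fixpoint Cn (n : nat) (f : R -> R) : Prop :=
  match n with
  | O => True
  | S m => exists f' : R -> R, (forall x, is_derive f x (f' x)) /\ Cn m f'
  end.

Definition smooth (f : R -> R) : Prop := forall n, Cn n f.

Lemma Derive_eq (f f' : R -> R) :
  (forall x, is_derive f x (f' x)) -> Derive f = f'.
Proof.
intros H; apply functional_extensionality; intros x.
now apply is_derive_unique.
Qed.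

(** [Derive_n] differentiates on the outside, while [Cn] strips the innermost derivative; this
    passes from one to the other. *)
Lemma Derive_n_Derive (f : R -> R) (n : nat) :
  Derive_n (Derive f) n = Derive_n f (S n).
Proof.
induction n as [|n IH]; [reflexivity|].
change (Derive_n (Derive f) (S n)) with (Derive (Derive_n (Derive f) n)).
now rewrite IH.
Qed.

Lemma ex_derive_n_iff_smooth (f : R -> R) :
  (forall n x, ex_derive_n f n x) <-> smooth f.
Proof.
split.
- intros H n; revert f H; induction n as [|n IH]; intros f H; [exact I|].
  exists (Derive f); split.
  + intros x; apply Derive_correct, (H 1%nat x).
  + apply IH; intros [|m] x; [exact I|].
    simpl; rewrite Derive_n_Derive; exact (H (S (S m)) x).
- intros H n; specialize (H n); revert f H.
  induction n as [|n IH]; intros f H x; [exact I|].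
  destruct H as [f' [D H]]; apply Derive_eq in D as E; subst f'.
  destruct n as [|n]; [now exists (Derive f x)|].
  specialize (IH _ H x); simpl in IH; rewrite Derive_n_Derive in IH; exact IH.
Qed.

Lemma Cn_S (n : nat) (f : R -> R) : Cn (S n) f -> Cn n f.
Proof.
revert f; induction n as [|n IH]; intros f H; [exact I|].
destruct H as [f' [D H]]; exists f'; auto.
Qed.

Lemma smooth_derive (f : R -> R) :
  smooth f -> (forall x, is_derive f x (Derive f x)) /\ smooth (Derive f).
Proof.
intros H; split.
- intros x; destruct (H 1%nat) as [f' [D _]].
  rewrite (Derive_eq _ _ D); apply D.
- intros n; destruct (H (S n)) as [f' [D Hn]].
  now rewrite (Derive_eq _ _ D).
Qed.

Lemma smooth_of_derive (f f' : R -> R) :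
  (forall x, is_derive f x (f' x)) -> smooth f' -> smooth f.
Proof. intros D H [|n]; [exact I|]; exists f'; auto. Qed.

Lemma smooth_is_derive (f : R -> R) (x : R) : smooth f -> is_derive f x (Derive f x).
Proof. intros H; apply smooth_derive, H. Qed.

Lemma smooth_Derive (f : R -> R) : smooth f -> smooth (Derive f).
Proof. apply smooth_derive. Qed.

Lemma smooth_continuous (f : R -> R) (x : R) : smooth f -> continuous f x.
Proof.
intros H; apply (ex_derive_continuous f); eexists; now apply smooth_is_derive.
Qed.

Lemma Cn_const (n : nat) (c : R) : Cn n (fun _ => c).
Proof.
revert c; induction n as [|n IH]; intros c; [exact I|].
exists (fun _ => 0); split; [|apply IH].
intros x; apply @is_derive_const.
Qed.

Lemma Cn_id (n : nat) : Cn n (fun x => x).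
Proof.
destruct n as [|n]; [exact I|].
exists (fun _ => 1); split; [|apply Cn_const].
intros x; apply @is_derive_id.
Qed.

Lemma Cn_plus (n : nat) (f g : R -> R) :
  Cn n f -> Cn n g -> Cn n (fun x => f x + g x).
Proof.
revert f g; induction n as [|n IH]; intros f g Hf Hg; [exact I|].
destruct Hf as [f' [Df Hf]], Hg as [g' [Dg Hg]].
exists (fun x => f' x + g' x); split; [|auto].
intros x; now apply @is_derive_plus.
Qed.

Lemma Cn_mult (n : nat) (f g : R -> R) :
  Cn n f -> Cn n g -> Cn n (fun x => f x * g x).
Proof.
revert f g; induction n as [|n IH]; intros f g Hf Hg; [exact I|].
(* The product rule keeps undifferentiated factors, so [f] and [g] are also needed at order [n]. *)
pose proof (Cn_S _ _ Hf); pose proof (Cn_S _ _ Hg).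
destruct Hf as [f' [Df Hf]], Hg as [g' [Dg Hg]].
exists (fun x => f' x * g x + f x * g' x); split; [|apply Cn_plus; auto].
intros x; apply @is_derive_mult; auto; intros; apply Rmult_comm.
Qed.

Lemma Cn_comp (n : nat) (f g : R -> R) :
  Cn n f -> Cn n g -> Cn n (fun x => f (g x)).
Proof.
revert f g; induction n as [|n IH]; intros f g Hf Hg; [exact I|].
pose proof (Cn_S _ _ Hg).
destruct Hf as [f' [Df Hf]], Hg as [g' [Dg Hg]].
exists (fun x => g' x * f' (g x)); split; [|apply Cn_mult; auto].
intros x; now apply (is_derive_comp f g).
Qed.

(** The derivative - f' / f^2 contains / f again, but at one order less, where the induction
    hypothesis applies. *)
Lemma Cn_inv (n : nat) (f : R -> R) :
  (forall x, f x <> 0) -> Cn n f -> Cn n (fun x => / f x).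
Proof.
intros N; induction n as [|n IH]; intros Hf; [exact I|].
pose proof (IH (Cn_S _ _ Hf)).
destruct Hf as [f' [Df Hf]].
exists (fun x => (-1 * f' x) * (/ f x * / f x)); split.
- intros x.
  replace (-1 * f' x * (/ f x * / f x)) with (- f' x / f x ^ 2) by (field; auto).
  now apply is_derive_inv.
- repeat apply Cn_mult; auto; apply Cn_const.
Qed.

Lemma Cn_sqrt (n : nat) (f : R -> R) :
  (forall x, 0 < f x) -> Cn n f -> Cn n (fun x => sqrt (f x)).
Proof.
intros N; induction n as [|n IH]; intros Hf; [exact I|].
pose proof (IH (Cn_S _ _ Hf)).
destruct Hf as [f' [Df Hf]].
assert (Hs : forall x, 0 < sqrt (f x)) by (intros; now apply sqrt_lt_R0).
exists (fun x => f' x * (/ 2 * / sqrt (f x))); split.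
- intros x; specialize (Hs x).
  replace (f' x * (/ 2 * / sqrt (f x))) with (f' x / (2 * sqrt (f x)))
    by (field; lra).
  now apply is_derive_sqrt.
- repeat apply Cn_mult; auto; [apply Cn_const|].
  apply Cn_inv; auto; intros x; specialize (Hs x); lra.
Qed.

(** The induction carries both functions because each is, up to sign, the derivative of the
    other. *)
Lemma Cn_cos_sin (n : nat) : Cn n cos /\ Cn n sin.
Proof.
induction n as [|n [IH1 IH2]]; [split; exact I|].
split.
- exists (fun x => -1 * sin x); split; [|now apply Cn_mult; [apply Cn_const|]].
  intros x; replace (-1 * sin x) with (- sin x) by ring; apply is_derive_cos.
- exists cos; split; [|assumption]; apply is_derive_sin.
Qed.

Lemma smooth_const (c : R) : smooth (fun _ => c).
Proof. intros n; apply Cn_const. Qed.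

Lemma smooth_id : smooth (fun x => x).
Proof. intros n; apply Cn_id. Qed.

Lemma smooth_plus (f g : R -> R) :
  smooth f -> smooth g -> smooth (fun x => f x + g x).
Proof. intros Hf Hg n; apply Cn_plus; auto. Qed.

Lemma smooth_mult (f g : R -> R) :
  smooth f -> smooth g -> smooth (fun x => f x * g x).
Proof. intros Hf Hg n; apply Cn_mult; auto. Qed.

Lemma smooth_comp (f g : R -> R) :
  smooth f -> smooth g -> smooth (fun x => f (g x)).
Proof. intros Hf Hg n; apply Cn_comp; auto. Qed.

Lemma smooth_inv (f : R -> R) :
  (forall x, f x <> 0) -> smooth f -> smooth (fun x => / f x).
Proof. intros N Hf n; apply Cn_inv; auto. Qed.

Lemma smooth_sqrt (f : R -> R) :
  (forall x, 0 < f x) -> smooth f -> smooth (fun x => sqrt (f x)).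
Proof. intros N Hf n; apply Cn_sqrt; auto. Qed.

Lemma smooth_cos (f : R -> R) : smooth f -> smooth (fun x => cos (f x)).
Proof. intros Hf; apply smooth_comp; auto; intros n; apply Cn_cos_sin. Qed.

Lemma smooth_sin (f : R -> R) : smooth f -> smooth (fun x => sin (f x)).
Proof. intros Hf; apply smooth_comp; auto; intros n; apply Cn_cos_sin. Qed.

Lemma smooth_minus (f g : R -> R) :
  smooth f -> smooth g -> smooth (fun x => f x - g x).
Proof.
intros Hf Hg.
replace (fun x => f x - g x) with (fun x => f x + -1 * g x)
  by (apply functional_extensionality; intros; ring).
apply smooth_plus; auto; apply smooth_mult; auto; apply smooth_const.
Qed.

Lemma smooth_pow (f : R -> R) (k : nat) : smooth f -> smooth (fun x => f x ^ k).
Proof.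
intros Hf; induction k as [|k IH]; simpl; [apply smooth_const|].
now apply smooth_mult.
Qed.

Lemma smooth_div (f g : R -> R) :
  (forall x, g x <> 0) -> smooth f -> smooth g -> smooth (fun x => f x / g x).
Proof. intros; apply smooth_mult; auto; now apply smooth_inv. Qed.

Lemma is_derive_0_const (f : R -> R) (a b : R) :
  (forall x, is_derive f x 0) -> f a = f b.
Proof.
intros D.
destruct (MVT_gen f a b (fun _ => 0)) as [c [_ E]].
- intros; apply D.
- intros x _; apply derivable_continuous_pt; exists 0; apply is_derive_Reals, D.
- lra.
Qed.

(** * Lifts of circle maps *)

Lemma circ_add_period (x : R) (k : Z) : circ (x + IZR k * (2 * PI)) = circ x.
Proof.
assert (S0 : sin (IZR k * PI) = 0) by (apply sin_eq_0_1; now exists k).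
assert (S : sin (IZR k * (2 * PI)) = 0).
{ replace (IZR k * (2 * PI)) with (2 * (IZR k * PI)) by ring.
  rewrite sin_2a, S0; ring. }
assert (C : cos (IZR k * (2 * PI)) = 1).
{ replace (IZR k * (2 * PI)) with (2 * (IZR k * PI)) by ring.
  rewrite cos_2a_sin, S0; ring. }
apply S1_ext; simpl; rewrite ?cos_plus, ?sin_plus, S, C; ring.
Qed.

Lemma circ_2PI (x : R) : circ (x + 2 * PI) = circ x.
Proof. rewrite <- (circ_add_period x 1); f_equal; ring. Qed.

(** Here cos (a - b) = 1, so sin ((a - b) / 2) = 0 by the half-angle formula. *)
Lemma circ_eq (a b : R) : circ a = circ b -> exists k : Z, a = b + IZR k * (2 * PI).
Proof.
intros H; injection H as Hc Hs.
assert (C : cos (a - b) = 1).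
{ rewrite cos_minus, Hc, Hs; rewrite <- (sin2_cos2 b); unfold Rsqr; ring. }
replace (a - b) with (2 * ((a - b) / 2)) in C by field.
rewrite cos_2a_sin in C.
destruct (sin_eq_0_0 ((a - b) / 2)) as [k Hk]; [nra|].
exists k; lra.
Qed.

Lemma theta_circ (x : R) : exists k : Z, theta (circ x) = x + IZR k * (2 * PI).
Proof. apply circ_eq, circ_theta. Qed.

(** [theta] jumps along its cut, but it differs from any other angle by a multiple of the period,
    and such a shift leaves the difference quotient unchanged; so the choice of branch
    disappears. *)
Lemma dtheta_circ (f : S1 -> R) (x : R) :
  dtheta f (circ x) = Derive (fun t => f (circ t)) x.
Proof.
unfold dtheta; destruct (theta_circ x) as [k ->]; unfold Derive.
do 2 f_equal; apply functional_extensionality; intros h.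
replace (x + IZR k * (2 * PI) + h) with (x + h + IZR k * (2 * PI)) by ring.
now rewrite !circ_add_period.
Qed.

Lemma smooth_fun_iff (f : S1 -> R) : smooth_fun f <-> smooth (fun t => f (circ t)).
Proof. apply (ex_derive_n_iff_smooth (fun t => f (circ t))). Qed.

Lemma S1_ind_circ (P : S1 -> Prop) : (forall x, P (circ x)) -> forall p, P p.
Proof. intros H p; rewrite <- (circ_theta p); apply H. Qed.

Definition lift (F : S1 -> S1) (g : R -> R) : Prop := forall x, F (circ x) = circ (g x).

(** On (cos g, sin g) the form x dy - y dx becomes g' (cos^2 + sin^2). *)
Lemma pullback_lift (F : S1 -> S1) (g : R -> R) (x l : R) :
  lift F g -> is_derive g x l -> pullback F (circ x) = l.
Proof.
intros H D; unfold pullback; rewrite !dtheta_circ.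
replace (fun t => s1y (F (circ t))) with (fun t => sin (g t))
  by (apply functional_extensionality; intros; now rewrite H).
replace (fun t => s1x (F (circ t))) with (fun t => cos (g t))
  by (apply functional_extensionality; intros; now rewrite H).
assert (Es : Derive (fun t => sin (g t)) x = l * cos (g x)).
{ apply is_derive_unique, (is_derive_comp sin g); [apply is_derive_sin | exact D]. }
assert (Ec : Derive (fun t => cos (g t)) x = l * - sin (g x)).
{ apply is_derive_unique, (is_derive_comp cos g); [apply is_derive_cos | exact D]. }
rewrite Es, Ec, H; simpl.
transitivity (l * ((sin (g x))² + (cos (g x))²)); [unfold Rsqr; ring|].
rewrite sin2_cos2; ring.
Qed.

Lemma smooth_map_lift (F : S1 -> S1) (g : R -> R) : lift F g -> smooth g -> smooth_map F.
Proof.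
intros H Hg; split; apply smooth_fun_iff.
- replace (fun t => s1x (F (circ t))) with (fun t => cos (g t))
    by (apply functional_extensionality; intros; now rewrite H).
  now apply smooth_cos.
- replace (fun t => s1y (F (circ t))) with (fun t => sin (g t))
    by (apply functional_extensionality; intros; now rewrite H).
  now apply smooth_sin.
Qed.

Lemma smooth_pullback (F : S1 -> S1) :
  smooth_map F -> smooth (fun x => pullback F (circ x)).
Proof.
intros [Hx Hy]; apply smooth_fun_iff in Hx, Hy.
replace (fun x => pullback F (circ x)) with
  (fun x => s1x (F (circ x)) * Derive (fun t => s1y (F (circ t))) x
          - s1y (F (circ x)) * Derive (fun t => s1x (F (circ t))) x)
  by (apply functional_extensionality; intros; unfold pullback; now rewrite !dtheta_circ).
apply smooth_minus; apply smooth_mult; auto; now apply smooth_Derive.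
Qed.

(* Near [x] the lift is recovered from [F] by
   [g t = g x + asin (sin (g t - g x))]. *)
Lemma continuous_lift_is_derive (F : S1 -> S1) (g : R -> R) (x : R) :
  smooth_map F -> lift F g -> continuous g x -> is_derive g x (pullback F (circ x)).
Proof.
intros [Hx Hy] H C; apply smooth_fun_iff in Hx, Hy.
set (u := fun t => s1x (F (circ t))) in *.
set (v := fun t => s1y (F (circ t))) in *.
assert (Eu : forall t, u t = cos (g t)) by (intros; unfold u; now rewrite H).
assert (Ev : forall t, v t = sin (g t)) by (intros; unfold v; now rewrite H).
set (w := fun t => cos (g x) * v t - sin (g x) * u t).
apply (is_derive_ext_loc (fun t => g x + asin (w t))).
{ assert (L : locally x (fun t => ball (g x) (PI / 2) (g t))).
  { apply C; exists (mkposreal (PI / 2) PI2_RGT_0); auto. }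
  revert L; apply filter_imp; intros t B.
  unfold ball in B; simpl in B; unfold AbsRing_ball, abs, minus, plus, opp in B; simpl in B.
  apply Rabs_lt_between in B.
  unfold w; rewrite Eu, Ev.
  replace (cos (g x) * sin (g t) - sin (g x) * cos (g t)) with (sin (g t - g x))
    by (rewrite sin_minus; ring).
  rewrite asin_sin; lra. }
assert (W : w x = 0) by (unfold w; rewrite Eu, Ev; ring).
assert (Dw : is_derive w x (cos (g x) * Derive v x - sin (g x) * Derive u x)).
{ apply @is_derive_minus; apply @is_derive_scal; now apply smooth_is_derive. }
assert (Da : is_derive asin (w x) 1).
{ rewrite W; apply is_derive_Reals.
  apply (derive_pt_eq_1 asin 0 1 (derivable_pt_asin 0 ltac:(lra))).
  rewrite derive_pt_asin; unfold Rsqr.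
  rewrite Rmult_0_l, Rminus_0_r, sqrt_1; field. }
pose proof (is_derive_comp asin w x _ _ Da Dw) as D.
unfold pullback; rewrite !dtheta_circ, H; simpl.
fold u v.
replace (cos (g x) * Derive v x - sin (g x) * Derive u x) with
  (0 + (cos (g x) * Derive v x - sin (g x) * Derive u x) * 1) by ring.
apply @is_derive_plus; [apply @is_derive_const | exact D].
Qed.

Record degree_one_lift (F : S1 -> S1) (g : R -> R) : Prop := {
  dol_lift : lift F g;
  dol_smooth : smooth g;
  dol_period : forall x, g (x + 2 * PI) = g x + 2 * PI }.

(** [has_degree] supplies only a continuous lift. Its derivative is [pullback F], which is smooth,
    hence the lift is smooth. *)
Lemma degree_one_lift_iff (F : S1 -> S1) :
  smooth_map F /\ has_degree F 1 <-> exists g, degree_one_lift F g.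
Proof.
split.
- intros [HF [g [C [L P]]]]; exists g; split; auto.
  + apply (smooth_of_derive g (fun x => pullback F (circ x))).
    * intros x; now apply continuous_lift_is_derive.
    * now apply smooth_pullback.
  + intros x; rewrite P; ring.
- intros [g [L Hg P]]; split; [now apply (smooth_map_lift F g)|].
  exists g; repeat split; auto.
  + intros x; now apply smooth_continuous.
  + intros x; rewrite P; ring.
Qed.

Lemma degree_one_lift_comp (F G : S1 -> S1) (f g : R -> R) :
  degree_one_lift F f -> degree_one_lift G g ->
  degree_one_lift (fun p => F (G p)) (fun x => f (g x)).
Proof.
intros [Lf Sf Pf] [Lg Sg Pg]; split.
- intros x; now rewrite Lg, Lf.
- now apply smooth_comp.
- intros x; now rewrite Pg, Pf.
Qed.

Lemma pullback_degree_one_lift (F : S1 -> S1) (g : R -> R) (x : R) :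
  degree_one_lift F g -> pullback F (circ x) = Derive g x.
Proof.
intros [L Sg _]; apply (pullback_lift F g); auto; now apply smooth_is_derive.
Qed.

(** The increment [c] is 2 * PI for a lift of degree one and 0 for a function on the circle. *)
Lemma Derive_period (g : R -> R) (c x : R) :
  (forall y, g (y + 2 * PI) = g y + c) -> Derive g (x + 2 * PI) = Derive g x.
Proof.
intros P; unfold Derive; do 2 f_equal; apply functional_extensionality; intros h.
replace (x + 2 * PI + h) with (x + h + 2 * PI) by ring.
rewrite !P; f_equal; ring.
Qed.

Lemma pullback_comp (F G : S1 -> S1) (f g : R -> R) (p : S1) :
  lift F f -> smooth f -> lift G g -> smooth g ->
  pullback (fun p => F (G p)) p = pullback F (G p) * pullback G p.
Proof.
intros Lf Sf Lg Sg; revert p; apply S1_ind_circ; intros x.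
rewrite Lg.
rewrite (pullback_lift G g x (Derive g x)) by (auto; now apply smooth_is_derive).
rewrite (pullback_lift F f (g x) (Derive f (g x))) by (auto; now apply smooth_is_derive).
apply (pullback_lift _ (fun x => f (g x))); [intros y; now rewrite Lg, Lf|].
rewrite Rmult_comm; apply (is_derive_comp f g); now apply smooth_is_derive.
Qed.

(* The lift is a primitive [h] of the angular velocity [u v' - v u']: then
   [u cos h + v sin h] and [v cos h - u sin h] have zero derivative. *)
Lemma smooth_map_has_lift (F : S1 -> S1) :
  smooth_map F ->
  exists h, lift F h /\ smooth h /\ exists k : Z,
    forall x, h (x + 2 * PI) = h x + IZR k * (2 * PI).
Proof.
intros HF; pose proof (smooth_pullback F HF) as Sw.
set (w := fun x => pullback F (circ x)) in *.
destruct HF as [Hx Hy]; apply smooth_fun_iff in Hx, Hy.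
set (u := fun t => s1x (F (circ t))) in *.
set (v := fun t => s1y (F (circ t))) in *.
set (h := fun x => theta (F (circ 0)) + RInt w 0 x).
assert (Dh : forall x, is_derive h x (w x)).
{ intros x; unfold h; replace (w x) with (0 + w x) by ring.
  apply @is_derive_plus; [apply @is_derive_const|].
  apply (is_derive_RInt w _ 0); [|now apply smooth_continuous].
  apply filter_forall; intros y; apply (RInt_correct w).
  apply (ex_RInt_continuous w); intros; now apply smooth_continuous. }
assert (Sh : smooth h) by (now apply (smooth_of_derive h w)).
assert (N : forall t, u t ^ 2 + v t ^ 2 = 1) by (intros; apply s1_unit).
assert (Du : forall x, is_derive u x (Derive u x)) by (intros; now apply smooth_is_derive).
assert (Dv : forall x, is_derive v x (Derive v x)) by (intros; now apply smooth_is_derive).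
assert (Ew : forall x, w x = u x * Derive v x - v x * Derive u x)
  by (intros; unfold w, pullback; now rewrite !dtheta_circ).
(* Differentiating u^2 + v^2 = 1 makes (u, v) orthogonal to its derivative, which is therefore [w]
   times the rotated vector (- v, u). *)
assert (O : forall x, u x * Derive u x + v x * Derive v x = 0).
{ intros x.
  assert (D1 : is_derive (fun t => u t ^ 2 + v t ^ 2) x
    (2 * (u x * Derive u x + v x * Derive v x))).
  { auto_derive; [repeat split; now eexists; auto|].
    change (Derive (fun x0 : R => u x0) x) with (Derive u x).
    change (Derive (fun x0 : R => v x0) x) with (Derive v x); ring. }
  assert (D0 : is_derive (fun t => u t ^ 2 + v t ^ 2) x 0).
  { apply (is_derive_ext (fun _ => 1)); [intros; now rewrite N|apply @is_derive_const]. }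
  apply is_derive_unique in D1, D0; lra. }
assert (Eu : forall x, Derive u x = - v x * w x).
{ intros x; rewrite Ew; specialize (O x); specialize (N x).
  transitivity (Derive u x * (u x ^ 2 + v x ^ 2)); [rewrite N; ring|].
  replace (Derive u x * (u x ^ 2 + v x ^ 2))
    with (u x * (u x * Derive u x) + v x ^ 2 * Derive u x) by ring.
  replace (u x * Derive u x) with (- (v x * Derive v x)) by lra; ring. }
assert (Ev : forall x, Derive v x = u x * w x).
{ intros x; rewrite Ew; specialize (O x); specialize (N x).
  transitivity (Derive v x * (u x ^ 2 + v x ^ 2)); [rewrite N; ring|].
  replace (Derive v x * (u x ^ 2 + v x ^ 2))
    with (v x * (v x * Derive v x) + u x ^ 2 * Derive v x) by ring.
  replace (v x * Derive v x) with (- (u x * Derive u x)) by lra; ring. }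
assert (H0 : circ (h 0) = F (circ 0)).
{ unfold h; rewrite RInt_point; unfold zero; simpl; rewrite Rplus_0_r; apply circ_theta. }
assert (L : lift F h).
{ assert (u0 : u 0 = cos (h 0)) by (unfold u; now rewrite <- H0).
  assert (v0 : v 0 = sin (h 0)) by (unfold v; now rewrite <- H0).
  intros x.
  assert (Cx : u x * cos (h x) + v x * sin (h x) = 1).
  { transitivity (u 0 * cos (h 0) + v 0 * sin (h 0)).
    - apply (is_derive_0_const (fun x => u x * cos (h x) + v x * sin (h x))).
      intros y; auto_derive; [repeat split; now eexists; auto|].
      change (Derive (fun x0 : R => h x0) y) with (Derive h y).
      rewrite (is_derive_unique _ _ _ (Dh y)).
      change (Derive (fun x0 : R => u x0) y) with (Derive u y).
      change (Derive (fun x0 : R => v x0) y) with (Derive v y).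
      rewrite Eu, Ev; ring.
    - rewrite u0, v0, <- (sin2_cos2 (h 0)); unfold Rsqr; ring. }
  assert (Sx : v x * cos (h x) - u x * sin (h x) = 0).
  { transitivity (v 0 * cos (h 0) - u 0 * sin (h 0)).
    - apply (is_derive_0_const (fun x => v x * cos (h x) - u x * sin (h x))).
      intros y; auto_derive; [repeat split; now eexists; auto|].
      change (Derive (fun x0 : R => h x0) y) with (Derive h y).
      rewrite (is_derive_unique _ _ _ (Dh y)).
      change (Derive (fun x0 : R => u x0) y) with (Derive u y).
      change (Derive (fun x0 : R => v x0) y) with (Derive v y).
      rewrite Eu, Ev; ring.
    - rewrite u0, v0; ring. }
  (* [Cx] and [Sx] give the coordinates of F (circ x) in the frame rotated by [h x]; rotating back
     recovers the point. *)
  pose proof (sin2_cos2 (h x)) as T; unfold Rsqr in T.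
  apply S1_ext; simpl; fold (u x) (v x).
  - transitivity (u x * (sin (h x) * sin (h x) + cos (h x) * cos (h x)));
      [rewrite T; ring|].
    transitivity (cos (h x) * (u x * cos (h x) + v x * sin (h x))
                  - sin (h x) * (v x * cos (h x) - u x * sin (h x))); [ring|].
    rewrite Cx, Sx; ring.
  - transitivity (v x * (sin (h x) * sin (h x) + cos (h x) * cos (h x)));
      [rewrite T; ring|].
    transitivity (sin (h x) * (u x * cos (h x) + v x * sin (h x))
                  + cos (h x) * (v x * cos (h x) - u x * sin (h x))); [ring|].
    rewrite Cx, Sx; ring. }
exists h; split; [exact L|split; [exact Sh|]].
destruct (circ_eq (h (0 + 2 * PI)) (h 0)) as [k Hk].
{ now rewrite <- !L, circ_2PI. }
exists k; intros x.
(* The derivative [w] is periodic, so the increment over a period is constant and can be read off at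
   0. *)
assert (E : h (x + 2 * PI) - h x = h (0 + 2 * PI) - h 0).
{ apply (is_derive_0_const (fun x => h (x + 2 * PI) - h x)).
  intros y; replace 0 with (1 * w (y + 2 * PI) - w y)
    by (unfold w; rewrite circ_2PI; ring).
  apply @is_derive_minus; [|apply Dh].
  apply (is_derive_comp h (fun x => x + 2 * PI)); [apply Dh|].
  auto_derive; auto. }
lra.
Qed.

(* A larger degree would force the lift to reach [g 0 + 2 * PI] before
   [2 * PI], against injectivity. *)
Lemma injective_degree_one (F : S1 -> S1) :
  smooth_map F -> (forall p q, F p = F q -> p = q) -> (forall p, 0 < pullback F p) ->
  exists g, degree_one_lift F g.
Proof.
intros HF I Pos.
destruct (smooth_map_has_lift F HF) as [g [L [Sg [k P]]]].
exists g; split; auto.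
pose proof PI_RGT_0.
assert (D : forall x, is_derive g x (pullback F (circ x)))
  by (intros; apply continuous_lift_is_derive; auto; now apply smooth_continuous).
assert (Mono : forall a b, a < b -> g a < g b).
{ intros a b Hab.
  destruct (MVT_gen g a b (fun x => pullback F (circ x))) as [c [_ E]].
  - intros; apply D.
  - intros x _; apply derivable_continuous_pt; eexists; apply is_derive_Reals, D.
  - specialize (Pos (circ c)); nra. }
assert (k = 1%Z); [|subst; intros; rewrite P; ring].
pose proof (P 0) as P0; pose proof (Mono 0 (0 + 2 * PI) ltac:(lra)) as M0.
assert (K0 : (0 < k)%Z) by (apply lt_IZR; nra).
destruct (Z.eq_dec k 1) as [E | E]; [exact E | exfalso].
assert (K2 : 2 <= IZR k) by (apply IZR_le; lia).
destruct (IVT_gen g 0 (0 + 2 * PI) (g 0 + 2 * PI)) as [y [Hy Ey]].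
- intros x; apply derivable_continuous_pt; eexists; apply is_derive_Reals, D.
- rewrite Rmin_left, Rmax_right by lra; nra.
- rewrite Rmin_left, Rmax_right in Hy by lra.
  assert (C : circ y = circ 0) by (apply I; rewrite !L, Ey; apply circ_2PI).
  destruct (circ_eq _ _ C) as [j Hj].
  (* Since [y] lies in [0, 2 * PI], it is an endpoint; the values of [g] there are g 0 and g 0 + k *
     2 * PI with k >= 2, neither of which is g 0 + 2 * PI. *)
  assert (J : j = 0%Z \/ j = 1%Z).
  { assert (0 <= j)%Z by (apply le_IZR; nra).
    assert (j <= 1)%Z by (apply le_IZR; nra).
    lia. }
  destruct J; subst j.
  + rewrite Hj in Ey; replace (0 + 0 * (2 * PI)) with 0 in Ey by ring; lra.
  + rewrite Hj in Ey; replace (0 + 1 * (2 * PI)) with (0 + 2 * PI) in Ey by ring; nra.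
Qed.

(** * Orientation preserving diffeomorphisms of the circle *)

Lemma pullback_id (p : S1) : pullback (fun p => p) p = 1.
Proof.
revert p; apply S1_ind_circ; intros x.
apply (pullback_lift _ (fun x => x)); [intros y; reflexivity | apply @is_derive_id].
Qed.

(** This is the chain rule for S o F = id. The lifts come from [smooth_map_has_lift], so it applies
    before the degrees are known. *)
Lemma pullback_left_inverse (F S : S1 -> S1) (p : S1) :
  smooth_map F -> smooth_map S -> (forall p, S (F p) = p) ->
  pullback S (F p) * pullback F p = 1.
Proof.
intros HF HS I.
destruct (smooth_map_has_lift F HF) as [f [Lf [Sf _]]].
destruct (smooth_map_has_lift S HS) as [h [Lh [Sh _]]].
rewrite <- (pullback_comp S F h f) by assumption.
replace (fun p => S (F p)) with (fun p : S1 => p)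
  by (apply functional_extensionality; intros; now rewrite I).
apply pullback_id.
Qed.

(** Carrying the inverse and the lifts of both maps makes the notion symmetric and stable under
    composition. *)
Definition circle_diffeo (F S : S1 -> S1) : Prop :=
  (exists f, degree_one_lift F f) /\ (exists h, degree_one_lift S h) /\
  (forall p, S (F p) = p) /\ (forall p, F (S p) = p).

(* The derivative of the lift has mean value 1 and does not vanish. *)
Lemma pullback_pos (F S : S1 -> S1) (f : R -> R) (p : S1) :
  degree_one_lift F f -> smooth_map S -> (forall p, S (F p) = p) -> 0 < pullback F p.
Proof.
intros Hf HS I; revert p; apply S1_ind_circ; intros x.
assert (HF : smooth_map F) by (apply (smooth_map_lift F f); apply Hf).
rewrite (pullback_degree_one_lift F f x Hf).
assert (N : forall y, Derive f y <> 0).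
{ intros y E; rewrite <- (pullback_degree_one_lift F f y Hf) in E.
  pose proof (pullback_left_inverse F S (circ y) HF HS I) as J.
  rewrite E in J; lra. }
destruct Hf as [_ Sf P]; pose proof PI_RGT_0.
destruct (MVT_gen f 0 (0 + 2 * PI) (Derive f)) as [c [_ E]].
{ intros; now apply smooth_is_derive. }
{ intros y _; apply derivable_continuous_pt; eexists; apply is_derive_Reals.
  now apply smooth_is_derive. }
rewrite P in E.
assert (C1 : Derive f c = 1) by nra.
destruct (Rlt_le_dec 0 (Derive f x)) as [L | L]; [exact L | exfalso].
destruct (IVT_gen (Derive f) x c 0) as [y [_ Ey]].
- intros y; apply derivable_continuous_pt; eexists; apply is_derive_Reals.
  apply smooth_is_derive; now apply smooth_Derive.
- rewrite Rmin_left, Rmax_right by lra; lra.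
- exact (N y Ey).
Qed.

Lemma circle_diffeo_pullback_pos (F S : S1 -> S1) (p : S1) :
  circle_diffeo F S -> 0 < pullback F p.
Proof.
intros [[f Hf] [[h Hh] [I _]]]; apply (pullback_pos F S f); auto.
apply (smooth_map_lift S h); apply Hh.
Qed.

(** What has to be found is the degree of [S]. It is injective because [F] undoes it, and its
    derivative is positive because its product with that of [F] is 1; so [injective_degree_one]
    applies. *)
Lemma circle_diffeo_of_smooth_inverse (F S : S1 -> S1) (f : R -> R) :
  degree_one_lift F f -> smooth_map S ->
  (forall p, S (F p) = p) -> (forall p, F (S p) = p) -> circle_diffeo F S.
Proof.
intros Hf HS I J.
assert (HF : smooth_map F) by (apply (smooth_map_lift F f); apply Hf).
repeat split; auto; [now exists f|].
apply injective_degree_one; auto.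
- intros p q E; now rewrite <- (J p), <- (J q), E.
- intros p; pose proof (pullback_left_inverse F S (S p) HF HS I) as E.
  pose proof (pullback_pos F S f (S p) Hf HS I).
  rewrite J in E; nra.
Qed.

Lemma circle_diffeo_sym (F S : S1 -> S1) : circle_diffeo F S -> circle_diffeo S F.
Proof. intros [H1 [H2 [H3 H4]]]; repeat split; assumption. Qed.

Lemma circle_diffeo_comp (F F' G G' : S1 -> S1) :
  circle_diffeo F F' -> circle_diffeo G G' ->
  circle_diffeo (fun p => F (G p)) (fun p => G' (F' p)).
Proof.
intros [[f Hf] [[f' Hf'] [F1 F2]]] [[g Hg] [[g' Hg'] [G1 G2]]].
repeat split.
- eexists; apply degree_one_lift_comp; eassumption.
- eexists; apply degree_one_lift_comp; eassumption.
- intros p; now rewrite F1.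
- intros p; now rewrite G2.
Qed.

(** [inverse] chooses some preimage; injectivity of [F] leaves only one. *)
Lemma inverse_circle_diffeo (F S : S1 -> S1) : circle_diffeo F S -> inverse F = S.
Proof.
intros [_ [_ [I J]]]; apply functional_extensionality; intros q; unfold inverse.
rewrite <- (I (epsilon _ _)); f_equal.
apply (epsilon_spec (inhabits (circ 0)) (fun p => F p = q)); now exists (S q).
Qed.

(** * Curves through their tangent maps, the rotation [T0], and duality *)

Lemma Dinf_iff (s : curve) :
  Dinf s <-> 0 < len s /\ exists g, degree_one_lift (tangent s) g.
Proof. rewrite <- degree_one_lift_iff; unfold Dinf; tauto. Qed.

Lemma Dinf_plus_iff (s : curve) :
  Dinf_plus s <-> 0 < len s /\ exists S, circle_diffeo (tangent s) S.
Proof.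
unfold Dinf_plus; rewrite Dinf_iff; split.
- intros [[H0 [g Hg]] [S [HS [I J]]]]; split; [exact H0|].
  exists S; now apply (circle_diffeo_of_smooth_inverse _ _ g).
- intros [H0 [S [Hg [[h Hh] [I J]]]]]; repeat split; auto.
  exists S; repeat split; auto; apply (smooth_map_lift S h); apply Hh.
Qed.

(** [T0] is the rotation by a quarter turn, so its inverse subtracts PI / 2 from the angle. *)
Definition T0_inv (p : S1) : S1 := circ (theta p - PI / 2).

Lemma T0_circ (x : R) : T0 (circ x) = circ (x + PI / 2).
Proof.
transitivity (circ (theta (circ x) + PI / 2)).
- apply S1_ext; simpl.
  + now rewrite cos_plus, cos_PI2, sin_PI2, Rmult_0_r, Rmult_1_r, Rminus_0_l.
  + now rewrite sin_plus, cos_PI2, sin_PI2, Rmult_0_r, Rmult_1_r, Rplus_0_l.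
- destruct (theta_circ x) as [k ->].
  rewrite <- (circ_add_period (x + PI / 2) k); f_equal; ring.
Qed.

Lemma T0_inv_circ (x : R) : T0_inv (circ x) = circ (x - PI / 2).
Proof.
unfold T0_inv; destruct (theta_circ x) as [k ->].
rewrite <- (circ_add_period (x - PI / 2) k); f_equal; ring.
Qed.

Lemma T0_degree_one_lift : degree_one_lift T0 (fun x => x + PI / 2).
Proof.
split; [exact T0_circ | | intros; ring].
apply smooth_plus; [apply smooth_id | apply smooth_const].
Qed.

Lemma circle_diffeo_T0 : circle_diffeo T0 T0_inv.
Proof.
repeat split.
- eexists; apply T0_degree_one_lift.
- exists (fun x => x - PI / 2); split; [exact T0_inv_circ | | intros; ring].
  apply smooth_minus; [apply smooth_id | apply smooth_const].
- apply S1_ind_circ; intros x; rewrite T0_circ, T0_inv_circ; f_equal; ring.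
- apply S1_ind_circ; intros x; rewrite T0_inv_circ, T0_circ; f_equal; ring.
Qed.

Lemma T0K (p : S1) : T0_inv (T0 p) = p.
Proof. apply circle_diffeo_T0. Qed.

Lemma T0_invK (p : S1) : T0 (T0_inv p) = p.
Proof. apply circle_diffeo_T0. Qed.

Lemma induced_eq (s : curve) : induced s = (fun p => T0_inv (tangent s p)).
Proof.
apply functional_extensionality; intros p; unfold induced.
now rewrite (inverse_circle_diffeo _ _ circle_diffeo_T0).
Qed.

(** The induced diffeomorphism is T0_inv o T, with inverse S o T0; one more [T0] turns that into a
    tangent map. *)
Lemma dual_eq (s : curve) (S : S1 -> S1) :
  circle_diffeo (tangent s) S ->
  dual s = mkCurve (fun p => T0 (S (T0 p))) (base s) (len s).
Proof.
intros H; unfold dual, of_induced; f_equal.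
rewrite induced_eq, (inverse_circle_diffeo _ (fun p => S (T0 p))); [reflexivity|].
apply (circle_diffeo_comp T0_inv T0 (tangent s) S); [|exact H].
apply circle_diffeo_sym, circle_diffeo_T0.
Qed.

Lemma curve_lact_eq (A : SL2) (s : curve) :
  curve_lact A s =
  mkCurve (fun p => T0 (Gamma A (T0_inv (tangent s p)))) (base s) (len s).
Proof. unfold curve_lact, of_induced; now rewrite induced_eq. Qed.

Lemma circle_diffeo_dual (F S : S1 -> S1) :
  circle_diffeo F S ->
  circle_diffeo (fun p => T0 (S (T0 p))) (fun p => T0_inv (F (T0_inv p))).
Proof.
intros H.
apply (circle_diffeo_comp T0 T0_inv (fun p => S (T0 p)) (fun p => T0_inv (F p))).
- exact circle_diffeo_T0.
- apply circle_diffeo_comp; [now apply circle_diffeo_sym | exact circle_diffeo_T0].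
Qed.

Lemma involution_dual : involution_on Dinf_plus dual.
Proof.
split; intros s H; apply Dinf_plus_iff in H as [L [S H]].
- rewrite (dual_eq s S H); apply Dinf_plus_iff; split; [exact L|].
  eexists; apply circle_diffeo_dual; exact H.
- rewrite (dual_eq s S H).
  rewrite (dual_eq _ (fun p => T0_inv (tangent s (T0_inv p))))
    by (apply circle_diffeo_dual; exact H).
  destruct s as [T b l]; simpl; f_equal.
  apply functional_extensionality; intros p; now rewrite T0_invK, T0K.
Qed.

(** * The action of SL(2,R) *)

Lemma SL2_ext (A B : SL2) :
  m11 A = m11 B -> m12 A = m12 B -> m21 A = m21 B -> m22 A = m22 B -> A = B.
Proof.
destruct A, B; simpl; intros -> -> -> ->; f_equal; apply proof_irrelevance.
Qed.

Lemma SL2_mulV (A : SL2) : SL2_mul A (SL2_inv A) = SL2_one.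
Proof. pose proof (SL2_det A); apply SL2_ext; simpl; lra. Qed.

Lemma SL2_mulVl (A : SL2) : SL2_mul (SL2_inv A) A = SL2_one.
Proof. pose proof (SL2_det A); apply SL2_ext; simpl; lra. Qed.

(** The reciprocal of this squared length is the derivative of [Gamma A], see [pullback_Gamma]. *)
Definition norm2 (A : SL2) (p : S1) : R := applyx A p ^ 2 + applyy A p ^ 2.

Lemma norm2_pos (A : SL2) (p : S1) : 0 < norm2 A p.
Proof.
(* The left side is the squared length of the inverse of [A] applied to A p, that is, of the unit
   vector [p]. *)
assert (E : (m22 A * applyx A p - m12 A * applyy A p) ^ 2
          + (m11 A * applyy A p - m21 A * applyx A p) ^ 2 = 1).
{ transitivity ((m11 A * m22 A - m12 A * m21 A) ^ 2 * (s1x p ^ 2 + s1y p ^ 2));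
    [unfold applyx, applyy; ring|].
  rewrite SL2_det, s1_unit; ring. }
unfold norm2.
destruct (Rlt_le_dec 0 (applyx A p ^ 2 + applyy A p ^ 2)) as [|H]; [assumption|].
assert (H1 : applyx A p = 0) by nra.
assert (H2 : applyy A p = 0) by nra.
rewrite H1, H2 in E; lra.
Qed.

Lemma apply_norm_pos (A : SL2) (p : S1) : 0 < apply_norm A p.
Proof. apply sqrt_lt_R0, norm2_pos. Qed.

Lemma apply_norm_sqr (A : SL2) (p : S1) : apply_norm A p ^ 2 = norm2 A p.
Proof. apply pow2_sqrt, Rlt_le, norm2_pos. Qed.

(** Homogeneity of the norm gives this cocycle relation; it makes the weights in [fun_ract] compose.
    The proof compares squares of positive numbers. *)
Lemma apply_norm_Gamma (A B : SL2) (p : S1) :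
  apply_norm A (Gamma B p) = apply_norm (SL2_mul A B) p / apply_norm B p.
Proof.
pose proof (apply_norm_pos B p).
pose proof (apply_norm_pos (SL2_mul A B) p).
pose proof (apply_norm_pos A (Gamma B p)).
assert (E : apply_norm A (Gamma B p) ^ 2
          = (apply_norm (SL2_mul A B) p / apply_norm B p) ^ 2).
{ unfold Rdiv; rewrite Rpow_mult_distr, !apply_norm_sqr; unfold norm2, applyx, applyy; simpl.
  unfold applyx, applyy; field; lra. }
assert (0 < apply_norm (SL2_mul A B) p / apply_norm B p) by now apply Rdiv_lt_0_compat.
nra.
Qed.

Lemma Gamma_mul (A B : SL2) (p : S1) : Gamma A (Gamma B p) = Gamma (SL2_mul A B) p.
Proof.
pose proof (apply_norm_pos B p).
pose proof (apply_norm_pos (SL2_mul A B) p).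
apply S1_ext; simpl; rewrite apply_norm_Gamma; unfold applyx, applyy; simpl;
  unfold applyx, applyy; field; lra.
Qed.

Lemma apply_norm_one (p : S1) : apply_norm SL2_one p = 1.
Proof.
unfold apply_norm, applyx, applyy.
replace (_ + _) with (s1x p ^ 2 + s1y p ^ 2) by (simpl; ring).
rewrite s1_unit; apply sqrt_1.
Qed.

Lemma Gamma_one (p : S1) : Gamma SL2_one p = p.
Proof.
apply S1_ext; simpl; rewrite apply_norm_one; unfold applyx, applyy; simpl; field.
Qed.

Lemma smooth_norm2 (A : SL2) : smooth (fun x => norm2 A (circ x)).
Proof.
unfold norm2, applyx, applyy; simpl s1x; simpl s1y.
apply smooth_plus; apply smooth_pow; apply smooth_plus;
  apply smooth_mult; auto using smooth_const, smooth_cos, smooth_sin, smooth_id.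
Qed.

Lemma smooth_Gamma (A : SL2) : smooth_map (Gamma A).
Proof.
assert (N : forall x, apply_norm A (circ x) <> 0).
{ intros x; apply Rgt_not_eq, apply_norm_pos. }
assert (Sn : smooth (fun x => apply_norm A (circ x))).
{ apply smooth_sqrt; [intros; apply norm2_pos | apply smooth_norm2]. }
split; apply smooth_fun_iff; simpl; apply smooth_div; auto;
  unfold applyx, applyy; simpl s1x; simpl s1y; apply smooth_plus;
  apply smooth_mult; auto using smooth_const, smooth_cos, smooth_sin, smooth_id.
Qed.

(** With (X, Y) = A (cos, sin) of norm n, the terms in n' cancel in x dy - y dx, leaving (X Y' - Y
    X') / n^2 = det A / n^2. *)
Lemma pullback_Gamma (A : SL2) (p : S1) : pullback (Gamma A) p = / norm2 A p.
Proof.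
revert p; apply S1_ind_circ; intros x.
pose proof (apply_norm_pos A (circ x)) as Hn.
set (n := fun t => apply_norm A (circ t)); fold (n x) in Hn.
assert (Sn : smooth n).
{ apply smooth_sqrt; [intros; apply norm2_pos | apply smooth_norm2]. }
pose proof (smooth_is_derive n x Sn) as Dn.
unfold pullback; rewrite !dtheta_circ.
assert (Dy : Derive (fun t => s1y (Gamma A (circ t))) x =
  (((- m21 A * sin x + m22 A * cos x) * n x - applyy A (circ x) * Derive n x) / n x ^ 2)).
{ apply is_derive_unique, (is_derive_div (fun t => applyy A (circ t)) n); [|exact Dn|lra].
  unfold applyy; simpl; auto_derive; [auto|ring]. }
assert (Dx : Derive (fun t => s1x (Gamma A (circ t))) x =
  (((- m11 A * sin x + m12 A * cos x) * n x - applyx A (circ x) * Derive n x) / n x ^ 2)).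
{ apply is_derive_unique, (is_derive_div (fun t => applyx A (circ t)) n); [|exact Dn|lra].
  unfold applyx; simpl; auto_derive; [auto|ring]. }
rewrite Dx, Dy; simpl s1x; simpl s1y; fold (n x).
rewrite <- apply_norm_sqr; fold (n x).
transitivity ((m11 A * m22 A - m12 A * m21 A) * ((sin x)² + (cos x)²) / n x ^ 2).
- unfold applyx, applyy, Rsqr; simpl; field; lra.
- rewrite SL2_det, sin2_cos2; field; lra.
Qed.

Lemma pullback_Gamma_pos (A : SL2) (p : S1) : 0 < pullback (Gamma A) p.
Proof. rewrite pullback_Gamma; apply Rinv_0_lt_compat, norm2_pos. Qed.

(** No explicit lift is written down: injectivity and the positive derivative already force degree
    one. *)
Lemma circle_diffeo_Gamma (A : SL2) : circle_diffeo (Gamma A) (Gamma (SL2_inv A)).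
Proof.
assert (L : forall B p, Gamma (SL2_inv B) (Gamma B p) = p)
  by (intros; now rewrite Gamma_mul, SL2_mulVl, Gamma_one).
assert (D : forall B, exists g, degree_one_lift (Gamma B) g).
{ intros B; apply injective_degree_one;
    [apply smooth_Gamma | | apply pullback_Gamma_pos].
  intros p q E; now rewrite <- (L B p), E. }
repeat split; auto.
intros p; now rewrite Gamma_mul, SL2_mulV, Gamma_one.
Qed.

(** * The actions on curves and functions, and their exchange by duality *)

Lemma left_action_curve_lact : left_action Dinf_plus curve_lact.
Proof.
repeat apply conj.
- intros A s H; apply Dinf_plus_iff in H as [L [S H]].
  rewrite curve_lact_eq; apply Dinf_plus_iff; split; [exact L|].
  exists (fun p => S (T0 (Gamma (SL2_inv A) (T0_inv p)))).
  apply (circle_diffeo_comp T0 T0_inv (fun p => Gamma A (T0_inv (tangent s p)))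
    (fun p => S (T0 (Gamma (SL2_inv A) p)))); [exact circle_diffeo_T0|].
  apply (circle_diffeo_comp (Gamma A) (Gamma (SL2_inv A))
    (fun p => T0_inv (tangent s p)) (fun p => S (T0 p)));
    [apply circle_diffeo_Gamma|].
  apply circle_diffeo_comp; [apply circle_diffeo_sym, circle_diffeo_T0 | exact H].
- intros s _; rewrite curve_lact_eq; destruct s as [T b l]; simpl; f_equal.
  apply functional_extensionality; intros p; now rewrite Gamma_one, T0_invK.
- intros A B s _; rewrite !curve_lact_eq; simpl; f_equal.
  apply functional_extensionality; intros p; now rewrite T0K, Gamma_mul.
Qed.

Lemma curve_ract_one (s : curve) : curve_ract s SL2_one = s.
Proof.
destruct s as [T b l]; unfold curve_ract; simpl; f_equal.
apply functional_extensionality; intros p; now rewrite Gamma_one.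
Qed.

Lemma curve_ract_mul (s : curve) (A B : SL2) :
  curve_ract (curve_ract s A) B = curve_ract s (SL2_mul A B).
Proof.
unfold curve_ract; simpl; f_equal.
apply functional_extensionality; intros p; now rewrite Gamma_mul.
Qed.

Lemma right_action_curve_ract : right_action Dinf_plus curve_ract.
Proof.
repeat apply conj.
- intros s A H; apply Dinf_plus_iff in H as [L [S H]].
  apply Dinf_plus_iff; split; [exact L|].
  exists (fun p => Gamma (SL2_inv A) (S p)).
  apply (circle_diffeo_comp (tangent s) S); [exact H | apply circle_diffeo_Gamma].
- intros s _; apply curve_ract_one.
- intros s A B _; apply curve_ract_mul.
Qed.

(** Inverting a composition reverses its order: the inverse of Gamma A o phi is the inverse of phi
    after that of [Gamma A]. *)
Lemma dual_curve_lact (A : SL2) (s : curve) :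
  Dinf_plus s -> dual (curve_lact A s) = curve_ract (dual s) (SL2_inv A).
Proof.
intros H; apply Dinf_plus_iff in H as [L [S H]].
rewrite (dual_eq s S H), curve_lact_eq.
rewrite (dual_eq _ (fun p => S (T0 (Gamma (SL2_inv A) (T0_inv p))))).
- unfold curve_ract; simpl; f_equal.
  apply functional_extensionality; intros p; now rewrite T0K.
- apply (circle_diffeo_comp T0 T0_inv (fun p => Gamma A (T0_inv (tangent s p)))
    (fun p => S (T0 (Gamma (SL2_inv A) p)))); [exact circle_diffeo_T0|].
  apply (circle_diffeo_comp (Gamma A) (Gamma (SL2_inv A))
    (fun p => T0_inv (tangent s p)) (fun p => S (T0 p)));
    [apply circle_diffeo_Gamma|].
  apply circle_diffeo_comp; [apply circle_diffeo_sym, circle_diffeo_T0 | exact H].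
Qed.

Lemma fun_ract_eq (f : S1 -> R) (A : SL2) (p : S1) :
  fun_ract f A p = apply_norm A p * f (Gamma A p).
Proof.
unfold fun_ract; rewrite pullback_Gamma, sqrt_inv, Rinv_inv; reflexivity.
Qed.

Lemma smooth_fun_ract (f : S1 -> R) (A : SL2) : smooth_fun f -> smooth_fun (fun_ract f A).
Proof.
intros Hf; apply smooth_fun_iff in Hf; apply smooth_fun_iff.
destruct (circle_diffeo_Gamma A) as [[g [Lg Sg _]] _].
replace (fun t => fun_ract f A (circ t))
  with (fun t => sqrt (norm2 A (circ t)) * f (circ (g t)))
  by (apply functional_extensionality; intros t; now rewrite fun_ract_eq, Lg).
apply smooth_mult.
- apply smooth_sqrt; [intros; apply norm2_pos | apply smooth_norm2].
- now apply (smooth_comp (fun t => f (circ t)) g).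
Qed.

Lemma right_action_pair_ract : right_action Dinf_fun pair_ract.
Proof.
repeat apply conj.
- intros [s f] A [H Hf]; simpl in *; split; simpl; [|now apply smooth_fun_ract].
  apply Dinf_iff in H as [L [g Hg]]; apply Dinf_iff; split; [exact L|].
  destruct (circle_diffeo_Gamma A) as [[h Hh] _].
  exists (fun x => g (h x)); now apply (degree_one_lift_comp (tangent s)).
- intros [s f] _; unfold pair_ract; simpl; f_equal; [apply curve_ract_one|].
  apply functional_extensionality; intros p; rewrite fun_ract_eq, Gamma_one.
  rewrite apply_norm_one; ring.
- intros [s f] A B _; unfold pair_ract; simpl; f_equal; [apply curve_ract_mul|].
  apply functional_extensionality; intros p; rewrite !fun_ract_eq, Gamma_mul.
  rewrite apply_norm_Gamma; pose proof (apply_norm_pos B p); field; lra.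
Qed.

(** * Energies *)

Lemma ex_RInt_smooth (f : R -> R) (a b : R) : smooth f -> ex_RInt f a b.
Proof.
intros H; apply (ex_RInt_continuous f); intros; now apply smooth_continuous.
Qed.

Lemma RInt_eq (f g : R -> R) (a b : R) :
  (forall x, f x = g x) -> RInt f a b = RInt g a b.
Proof. intros H; apply (RInt_ext f g); intros; apply H. Qed.

Lemma RInt_scal_smooth (c : R) (f : R -> R) (a b : R) :
  smooth f -> RInt (fun x => c * f x) a b = c * RInt f a b.
Proof. intros H; apply (RInt_scal f), ex_RInt_smooth, H. Qed.

(* With [P] a primitive of [I], the integrand [K] has primitive
   [P (g x) + D x], and [P (x + 2 * PI) - P x] does not depend on [x]. *)
Lemma RInt_change_of_variables (g I D D' K : R -> R) :
  smooth g -> (forall x, g (x + 2 * PI) = g x + 2 * PI) ->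
  smooth I -> (forall x, I (x + 2 * PI) = I x) ->
  (forall x, is_derive D x (D' x)) -> D (2 * PI) = D 0 -> smooth K ->
  (forall x, K x = I (g x) * Derive g x + D' x) ->
  RInt K 0 (2 * PI) = RInt I 0 (2 * PI).
Proof.
intros Sg Pg SI PI' DD PD SK EK.
set (P := fun x => RInt I 0 x).
assert (DP : forall x, is_derive P x (I x)).
{ intros x; apply (is_derive_RInt I _ 0); [|now apply smooth_continuous].
  apply filter_forall; intros y; apply (RInt_correct I), ex_RInt_smooth, SI. }
assert (J : is_RInt K 0 (2 * PI)
  (minus (P (g (2 * PI)) + D (2 * PI)) (P (g 0) + D 0))).
{ apply (is_RInt_derive (fun x => P (g x) + D x)).
  - intros x _; rewrite EK; apply @is_derive_plus; [|apply DD].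
    rewrite Rmult_comm; apply (is_derive_comp P g); [apply DP|].
    now apply smooth_is_derive.
  - intros x _; now apply smooth_continuous. }
rewrite (is_RInt_unique K _ _ _ J).
change (P (g (2 * PI)) + D (2 * PI) - (P (g 0) + D 0) = P (2 * PI) :> R).
assert (P0 : P 0 = 0) by apply (RInt_point 0 I).
assert (E : P (g 0 + 2 * PI) - P (g 0) = P (0 + 2 * PI) - P 0).
{ apply (is_derive_0_const (fun x => P (x + 2 * PI) - P x)); intros x.
  replace 0 with (1 * I (x + 2 * PI) - I x) by (rewrite PI'; ring).
  apply @is_derive_minus; [|apply DP].
  apply (is_derive_comp P (fun x => x + 2 * PI)); [apply DP|].
  auto_derive; auto. }
specialize (Pg 0); rewrite Rplus_0_l in Pg, E; rewrite Pg; lra.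
Qed.

Lemma smooth_E_S_integrand (F g : R -> R) :
  smooth F -> smooth g ->
  smooth (fun x => Derive F x ^ 2 + Derive g x ^ 2 * F x ^ 2 - F x ^ 2).
Proof.
intros HF Hg; apply smooth_minus; [apply smooth_plus; [|apply smooth_mult]|];
  apply smooth_pow; auto using smooth_Derive.
Qed.

(** Each of the three terms carries (2 * PI / L)^2 and the length element carries L / (2 * PI), so a
    single factor remains. *)
Lemma E_S_eq (s : curve) (f : S1 -> R) (F g : R -> R) :
  0 < len s -> degree_one_lift (tangent s) g -> (forall x, f (circ x) = F x) ->
  E_S s f = RInt (fun x => 2 * PI / len s *
    (Derive F x ^ 2 + Derive g x ^ 2 * F x ^ 2 - F x ^ 2)) 0 (2 * PI).
Proof.
intros L Hg HF; unfold E_S, int_curve; apply RInt_eq; intros x.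
pose proof PI_RGT_0.
unfold grad_norm, kappa; rewrite dtheta_circ, (pullback_degree_one_lift _ _ x Hg), HF.
replace (fun t => f (circ t)) with F
  by (apply functional_extensionality; intros; now rewrite HF).
rewrite Rpow_mult_distr, pow2_abs; field; lra.
Qed.

Lemma kappa_circ (s : curve) (g : R -> R) (x : R) :
  degree_one_lift (tangent s) g -> kappa s (circ x) = 2 * PI / len s * Derive g x.
Proof. intros Hg; unfold kappa; now rewrite (pullback_degree_one_lift _ _ x Hg). Qed.

Lemma dtheta_kappa_circ (s : curve) (g : R -> R) (x : R) :
  degree_one_lift (tangent s) g ->
  dtheta (kappa s) (circ x) = 2 * PI / len s * Derive (Derive g) x.
Proof.
intros Hg; rewrite dtheta_circ.
replace (fun t => kappa s (circ t)) with (fun t => 2 * PI / len s * Derive g t)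
  by (apply functional_extensionality; intros t; now rewrite (kappa_circ s g t Hg)).
apply Derive_scal.
Qed.

(** All powers of the length cancel here, whereas in [E_G_star] a factor 2 * PI / L survives; this
    is the origin of the factor in the duality formula. *)
Lemma E_G_eq (s : curve) (g : R -> R) :
  0 < len s -> degree_one_lift (tangent s) g -> (forall x, 0 < Derive g x) ->
  E_G s = RInt (fun x => Derive (Derive g) x ^ 2 / (4 * Derive g x ^ 3)
                         - / Derive g x) 0 (2 * PI) + 2 * PI.
Proof.
intros L Hg Pos; unfold E_G, int_curve; f_equal; apply RInt_eq; intros x.
pose proof PI_RGT_0; specialize (Pos x).
unfold grad_norm; rewrite (dtheta_kappa_circ s g x Hg), (kappa_circ s g x Hg).
rewrite Rpow_mult_distr, pow2_abs; field; lra.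
Qed.

Lemma E_G_star_eq (s : curve) (g : R -> R) :
  0 < len s -> degree_one_lift (tangent s) g -> (forall x, 0 < Derive g x) ->
  E_G_star s = RInt (fun x => 2 * PI / len s *
      (Derive (Derive g) x ^ 2 / (4 * Derive g x ^ 2) - Derive g x ^ 2)) 0 (2 * PI)
    + (2 * PI) ^ 2 / len s.
Proof.
intros L Hg Pos; unfold E_G_star, int_curve; f_equal; apply RInt_eq; intros x.
pose proof PI_RGT_0; specialize (Pos x).
unfold grad_norm; rewrite (dtheta_kappa_circ s g x Hg), (kappa_circ s g x Hg).
rewrite Rpow_mult_distr, pow2_abs; field; lra.
Qed.

(* [q = norm2 A (circ x)] is the squared length of [v = A (cos x, sin x)].  Since
   [v'' = - v], the identity says that [|v|^2 |v'|^2 - (v . v')^2 = det (v, v')^2 = 1];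
   it is the Schwarzian equation of the lift of [Gamma A]. *)
Lemma norm2_schwarzian (A : SL2) :
  exists q1 q2 : R -> R,
    (forall x, is_derive (fun t => norm2 A (circ t)) x (q1 x)) /\
    (forall x, is_derive q1 x (q2 x)) /\
    (forall x, q1 (x + 2 * PI) = q1 x) /\
    (forall x, 2 * norm2 A (circ x) * q2 x - q1 x ^ 2 + 4 * norm2 A (circ x) ^ 2 = 4).
Proof.
set (X := fun x => m11 A * cos x + m12 A * sin x).
set (Y := fun x => m21 A * cos x + m22 A * sin x).
set (X' := fun x => - m11 A * sin x + m12 A * cos x).
set (Y' := fun x => - m21 A * sin x + m22 A * cos x).
exists (fun x => 2 * (X x * X' x + Y x * Y' x)).
exists (fun x => 2 * (X' x ^ 2 + Y' x ^ 2 - X x ^ 2 - Y x ^ 2)).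
unfold norm2, applyx, applyy, X, Y, X', Y'; simpl s1x; simpl s1y.
repeat apply conj; intros x.
- auto_derive; [auto|ring].
- auto_derive; [auto|ring].
- pose proof (circ_2PI x) as E; injection E as -> ->; reflexivity.
- transitivity (4 * (m11 A * m22 A - m12 A * m21 A) ^ 2 * ((sin x)² + (cos x)²) ^ 2).
  + unfold Rsqr; ring.
  + rewrite SL2_det, sin2_cos2; ring.
Qed.

(** * Invariance of the energies and the duality between them *)

Lemma E_S_invariant (A : SL2) (s : curve) (f : S1 -> R) :
  Dinf s -> smooth_fun f -> E_S (curve_ract s A) (fun_ract f A) = E_S s f.
Proof.
intros H Hf; apply Dinf_iff in H as [L [t Ht]].
apply smooth_fun_iff in Hf as SF.
destruct (circle_diffeo_Gamma A) as [[g Hg] _].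
assert (Htg : degree_one_lift (tangent (curve_ract s A)) (fun x => t (g x)))
  by now apply (degree_one_lift_comp (tangent s)).
apply smooth_fun_ract with (A := A) in Hf; apply smooth_fun_iff in Hf.
set (F := fun x => f (circ x)) in *.
set (G := fun x => fun_ract f A (circ x)) in *.
rewrite (E_S_eq s f F t) by auto.
rewrite (E_S_eq (curve_ract s A) _ G _ L Htg) by auto.
change (len (curve_ract s A)) with (len s).
set (c := 2 * PI / len s).
set (q := fun x => norm2 A (circ x)).
assert (Q0 : forall x, 0 < q x) by (intros; apply norm2_pos).
assert (EG : forall x, G x = sqrt (q x) * F (g x))
  by (intros x; unfold G, F; now rewrite fun_ract_eq, (dol_lift _ _ Hg)).
destruct (norm2_schwarzian A) as [q1 [q2 [Dq [Dq1 [Pq1 Sch]]]]].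
change (forall x, is_derive q x (q1 x)) in Dq.
assert (Dg : forall x, Derive g x = / q x).
{ intros x; rewrite <- (pullback_degree_one_lift _ _ x Hg); apply pullback_Gamma. }
pose proof (dol_smooth _ _ Ht) as St; pose proof (dol_smooth _ _ Hg) as Sg.
pose proof (dol_smooth _ _ Htg) as Stg.
assert (DFg : forall x, is_derive (fun x => F (g x)) x (/ q x * Derive F (g x))).
{ intros x; rewrite <- Dg; apply (is_derive_comp F g); now apply smooth_is_derive. }
assert (DG : forall x, Derive G x =
  q1 x / (2 * sqrt (q x)) * F (g x) + sqrt (q x) * (/ q x * Derive F (g x))).
{ intros x; apply is_derive_unique.
  apply (is_derive_ext (fun x => sqrt (q x) * F (g x))); [intros; now rewrite EG|].
  apply (is_derive_mult (fun x => sqrt (q x)) (fun x => F (g x)));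
    [now apply (is_derive_sqrt q) | apply DFg | intros; apply Rmult_comm]. }
assert (Dtg : forall x, Derive (fun x => t (g x)) x = / q x * Derive t (g x)).
{ intros x; rewrite <- Dg; apply is_derive_unique, (is_derive_comp t g);
    now apply smooth_is_derive. }
assert (PF : forall x, F (x + 2 * PI) = F x + 0)
  by (intros; unfold F; rewrite circ_2PI; ring).
(* The boundary term is [- (g'' / g' ^ 2) / 2 * F (g x) ^ 2] with [g' = / q]. *)
apply (RInt_change_of_variables g _ (fun x => c * (q1 x / 2 * F (g x) ^ 2))
  (fun x => c * (q2 x / 2 * F (g x) ^ 2
                 + q1 x * F (g x) * (/ q x * Derive F (g x))))).
- exact Sg.
- apply (dol_period _ _ Hg).
- apply smooth_mult; [apply smooth_const|].
  now apply smooth_E_S_integrand.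
- intros x; rewrite (Derive_period F 0 x PF), PF, Rplus_0_r.
  rewrite (Derive_period t (2 * PI) x (dol_period _ _ Ht)); reflexivity.
- intros x; apply @is_derive_scal.
  evar_last; [apply @is_derive_mult|].
  + apply (is_derive_scal_l q1 x (q2 x) (/ 2)), Dq1.
  + apply (is_derive_pow (fun x => F (g x)) 2), DFg.
  + intros; apply Rmult_comm.
  + unfold scal, mult, plus; simpl; unfold mult; simpl; field; apply Rgt_not_eq, Q0.
- specialize (Pq1 0); pose proof (dol_period _ _ Hg 0) as Pg.
  rewrite Rplus_0_l in Pq1, Pg; now rewrite Pq1, Pg, PF, Rplus_0_r.
- apply smooth_mult; [apply smooth_const|].
  now apply smooth_E_S_integrand.
- intros x; rewrite DG, Dtg, EG, Dg; specialize (Sch x); fold (q x) in Sch.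
  specialize (Q0 x).
  pose proof (sqrt_lt_R0 _ Q0) as R0.
  (* Written in r = sqrt q, the identity to be proved is rational. *)
  assert (Eq : q x = sqrt (q x) ^ 2) by (rewrite pow2_sqrt; lra).
  set (r := sqrt (q x)) in *; rewrite Eq in Sch |- *.
  (* The Schwarzian identity solved for q''. The surplus coefficient q'^2 / (4 q) - q + 1 / q of F
     (g x)^2 thereby equals q'' / 2, as in the derivative of the boundary term. *)
  assert (E2 : q2 x = (4 - 4 * r ^ 4 + q1 x ^ 2) / (2 * r ^ 2)).
  { apply (Rmult_eq_reg_l (2 * r ^ 2)); [|nra].
    transitivity (4 - 4 * r ^ 4 + q1 x ^ 2); [lra | field; lra]. }
  rewrite E2; field; lra.
Qed.

(** For F = g'^(-1/2) one has F'^2 = g''^2 / (4 g'^3), g'^2 F^2 = g' and F^2 = 1 / g'. The integral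
    of g' over a period is 2 * PI, which is the additive constant of [E_G]. *)
Lemma E_G_E_S (s : curve) (S : S1 -> S1) :
  0 < len s -> circle_diffeo (tangent s) S ->
  smooth_fun (fun p => / sqrt (pullback (tangent s) p)) /\
  E_G s = len s / (2 * PI) * E_S s (fun p => / sqrt (pullback (tangent s) p)).
Proof.
intros L H.
pose proof (fun p => circle_diffeo_pullback_pos _ _ p H) as Pos.
destruct H as [[g Hg] _].
assert (Eg := fun x => pullback_degree_one_lift _ _ x Hg).
assert (Pg : forall x, 0 < Derive g x) by (intros; rewrite <- Eg; apply Pos).
assert (Sg := smooth_Derive _ (dol_smooth _ _ Hg)).
assert (SF : smooth (fun x => / sqrt (Derive g x))).
{ apply smooth_inv; [|now apply smooth_sqrt].
  intros x; now apply Rgt_not_eq, sqrt_lt_R0. }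
set (F := fun x => / sqrt (Derive g x)) in *.
assert (EF : forall x, / sqrt (pullback (tangent s) (circ x)) = F x)
  by (intros; unfold F; now rewrite Eg).
split.
{ apply smooth_fun_iff; replace (fun x => _) with F; [exact SF|].
  apply functional_extensionality; intros; now rewrite EF. }
rewrite (E_G_eq s g L Hg Pg), (E_S_eq s _ F g L Hg) by exact EF.
pose proof PI_RGT_0.
set (I := fun x => Derive F x ^ 2 + Derive g x ^ 2 * F x ^ 2 - F x ^ 2).
assert (SI : smooth I).
{ apply smooth_E_S_integrand; [exact SF | apply Hg]. }
rewrite (RInt_scal_smooth _ I) by exact SI.
assert (Ec : forall r, len s / (2 * PI) * (2 * PI / len s * r) = r)
  by (intros; field; lra).
rewrite Ec.
rewrite (RInt_eq I (fun x => (Derive (Derive g) x ^ 2 / (4 * Derive g x ^ 3)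
                               - / Derive g x) + Derive g x)).
- rewrite (RInt_plus (fun x => Derive (Derive g) x ^ 2 / (4 * Derive g x ^ 3)
                               - / Derive g x) (Derive g)).
  + unfold plus; simpl; f_equal.
    symmetry; apply is_RInt_unique.
    evar_last; [apply (is_RInt_derive g)|].
    * intros; apply smooth_is_derive, Hg.
    * intros; now apply smooth_continuous.
    * unfold minus, plus, opp; simpl.
      rewrite <- (Rplus_0_l (2 * PI)), (dol_period _ _ Hg); ring.
  + apply ex_RInt_smooth, smooth_minus.
    * apply smooth_div.
      -- intros x; pose proof (pow_lt _ 3 (Pg x)); lra.
      -- apply smooth_pow; now apply smooth_Derive.
      -- apply smooth_mult; [apply smooth_const | now apply smooth_pow].
    * apply smooth_inv; auto; intros x; apply Rgt_not_eq, Pg.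
  + now apply ex_RInt_smooth.
- intros x; unfold I.
  assert (r0 : 0 < sqrt (Derive g x)) by now apply sqrt_lt_R0.
  assert (DF : Derive F x = - (Derive (Derive g) x / (2 * sqrt (Derive g x)))
                            / sqrt (Derive g x) ^ 2).
  { apply is_derive_unique, (is_derive_inv (fun x => sqrt (Derive g x))); [|lra].
    apply is_derive_sqrt; [now apply smooth_is_derive | apply Pg]. }
  rewrite DF; unfold F.
  assert (Eq : Derive g x = sqrt (Derive g x) ^ 2)
    by (rewrite pow2_sqrt; [reflexivity | now apply Rlt_le]).
  set (r := sqrt (Derive g x)) in *; rewrite Eq; field; lra.
Qed.

Lemma E_G_invariant (A : SL2) (s : curve) :
  Dinf_plus s -> E_G (curve_ract s A) = E_G s.
Proof.
intros D; pose proof (proj1 D) as Ds.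
apply Dinf_plus_iff in D as [L [S H]].
pose proof (circle_diffeo_Gamma A) as HA.
pose proof (circle_diffeo_comp _ _ _ _ H HA) as HsA.
destruct (E_G_E_S s S L H) as [Sf ->].
destruct (E_G_E_S (curve_ract s A) _ L HsA) as [_ ->].
change (len (curve_ract s A)) with (len s); f_equal.
rewrite <- (E_S_invariant A s _ Ds Sf); f_equal.
apply functional_extensionality; intros p; unfold fun_ract.
destruct H as [[g [Lg Sg _]] _], HA as [[h [Lh Sh _]] _].
(* By the chain rule the power -1/2 of the derivative of T o Gamma A splits into the weight of
   [fun_ract] and the old function at Gamma A. *)
rewrite (pullback_comp (tangent s) (Gamma A) g h) by assumption.
rewrite Rmult_comm, sqrt_mult_alt, Rinv_mult; [reflexivity|].
apply Rlt_le, pullback_Gamma_pos.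
Qed.

Lemma E_G_dual (s : curve) :
  Dinf_plus s -> E_G (dual s) = len s / (2 * PI) * E_G_star s.
Proof.
intros D; apply Dinf_plus_iff in D as [L [S H]].
rewrite (dual_eq s S H).
pose proof (circle_diffeo_dual _ _ H) as HD.
pose proof (fun p => circle_diffeo_pullback_pos _ _ p H) as Pos.
pose proof (fun p => circle_diffeo_pullback_pos _ _ p HD) as PosD.
destruct H as [[g Hg] [[h Hh] [I J]]].
pose proof (degree_one_lift_comp _ _ _ _ Hh T0_degree_one_lift) as Hk.
(* [k] lifts S o T0; the tangent map of the dual has lift k + PI / 2, with the same derivative. *)
set (k := fun x => h (x + PI / 2)) in Hk.
pose proof (degree_one_lift_comp _ _ _ _ T0_degree_one_lift Hk) as Hd.
simpl in Hd.
assert (Eg := fun x => pullback_degree_one_lift _ _ x Hg).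
assert (Pg : forall x, 0 < Derive g x) by (intros; rewrite <- Eg; apply Pos).
assert (Sg := smooth_Derive _ (dol_smooth _ _ Hg)).
assert (Sk := dol_smooth _ _ Hk).
(* Differentiate T o (S o T0) = T0, where the rotation [T0] has derivative 1. *)
assert (Dk : forall x, Derive k x = / Derive g (k x)).
{ intros x; rewrite <- Eg, <- (dol_lift _ _ Hk), <- (pullback_degree_one_lift _ _ x Hk).
  assert (E : pullback T0 (circ x) = pullback (tangent s) (S (T0 (circ x)))
                                     * pullback (fun p => S (T0 p)) (circ x)).
  { rewrite <- (pullback_comp (tangent s) (fun p => S (T0 p)) g k)
      by (assumption || apply Hg || apply Hk).
    f_equal; apply functional_extensionality; intros p; now rewrite J. }
  rewrite (pullback_lift T0 _ x 1 T0_circ) in E by (auto_derive; auto).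
  specialize (Pos (S (T0 (circ x)))).
  apply (Rmult_eq_reg_l (pullback (tangent s) (S (T0 (circ x))))); [|lra].
  rewrite <- E; field; lra. }
assert (Dd : Derive (fun x => k x + PI / 2) = fun x => / Derive g (k x)).
{ apply functional_extensionality; intros x; rewrite <- Dk.
  apply is_derive_unique.
  replace (Derive k x) with (Derive k x + 0) by ring.
  apply @is_derive_plus; [now apply smooth_is_derive | apply @is_derive_const]. }
rewrite (E_G_eq (mkCurve _ _ _) (fun x => k x + PI / 2) L Hd)
  by (intros; rewrite Dd; now apply Rinv_0_lt_compat).
rewrite Dd, (E_G_star_eq s g L Hg Pg); simpl len.
set (W := fun x => Derive (Derive g) x ^ 2 / (4 * Derive g x ^ 2) - Derive g x ^ 2).
assert (SW : smooth W).
{ apply smooth_minus; [|now apply smooth_pow].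
  apply smooth_div.
  - intros x; pose proof (pow_lt _ 2 (Pg x)); lra.
  - apply smooth_pow; now apply smooth_Derive.
  - apply smooth_mult; [apply smooth_const | now apply smooth_pow]. }
rewrite (RInt_scal_smooth _ W) by exact SW.
pose proof PI_RGT_0.
transitivity (RInt W 0 (2 * PI) + 2 * PI); [f_equal | field; lra].
assert (EK : forall x, Derive (fun x => / Derive g (k x)) x
    = - (Derive k x * Derive (Derive g) (k x)) / Derive g (k x) ^ 2).
{ intros x; apply is_derive_unique, (is_derive_inv (fun x => Derive g (k x))).
  - apply (is_derive_comp (Derive g) k); now apply smooth_is_derive.
  - apply Rgt_not_eq, Pg. }
assert (P1 : forall x, Derive g (x + 2 * PI) = Derive g x + 0)
  by (intros; rewrite (Derive_period g (2 * PI) x (dol_period _ _ Hg)); ring).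
assert (SgK : smooth (fun x => Derive g (k x))) by now apply smooth_comp.
assert (Pi : forall x, 0 < / Derive g (k x)) by (intros; now apply Rinv_0_lt_compat).
assert (SiK : smooth (fun x => / Derive g (k x)))
  by (apply smooth_inv; auto; intros x; apply Rgt_not_eq, Pg).
(* With k' = 1 / g' (k), the integrand of [E_G] for the dual is exactly W (k) k', so the boundary
   term is zero. *)
apply (RInt_change_of_variables k W (fun _ => 0) (fun _ => 0)); auto.
- apply Hk.
- intros x; unfold W; rewrite (Derive_period _ 0 x P1), P1, Rplus_0_r; reflexivity.
- intros x; apply @is_derive_const.
- apply smooth_minus.
  + apply smooth_div.
    * intros x; pose proof (pow_lt _ 3 (Pi x)); lra.
    * apply smooth_pow; now apply smooth_Derive.
    * apply smooth_mult; [apply smooth_const | now apply smooth_pow].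
  + apply smooth_inv; auto; intros x; apply Rgt_not_eq, Pi.
- intros x; rewrite EK, Dk; unfold W; specialize (Pg (k x)); field; lra.
Qed.

(** The duality formula at [s] and at its image under [A] reduces this to the invariance of [E_G]
    under the right action of the inverse of [A]; the common positive factor L / (2 * PI) then
    cancels. *)
Lemma E_G_star_invariant (A : SL2) (s : curve) :
  Dinf_plus s -> E_G_star (curve_lact A s) = E_G_star s.
Proof.
intros H; pose proof (proj1 left_action_curve_lact A s H) as HA.
pose proof (E_G_dual s H) as E1; pose proof (E_G_dual _ HA) as E2.
rewrite dual_curve_lact, E_G_invariant in E2
  by (auto; now apply involution_dual).
change (len (curve_lact A s)) with (len s) in E2.
pose proof PI_RGT_0; apply Dinf_plus_iff in H as [L _].
apply (Rmult_eq_reg_l (len s / (2 * PI))); [lra|].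
apply Rgt_not_eq, Rdiv_lt_0_compat; lra.
Qed.

Theorem theorem1p2 :
  right_action Dinf_fun pair_ract /\
  right_action Dinf_plus curve_ract /\
  left_action Dinf_plus curve_lact /\
  (forall (A : SL2) (s : curve) (f : S1 -> R),
     Dinf s -> smooth_fun f ->
     E_S (fst (pair_ract (s, f) A)) (snd (pair_ract (s, f) A)) = E_S s f) /\
  (forall (A : SL2) (s : curve),
     Dinf_plus s ->
     E_G (curve_ract s A) = E_G s /\ E_G_star (curve_lact A s) = E_G_star s) /\
  involution_on Dinf_plus dual /\
  (forall (A : SL2) (s : curve),
     Dinf_plus s ->
     dual (curve_lact A s) = curve_ract (dual s) (SL2_inv A) /\
     E_G (dual s) = len s / (2 * PI) * E_G_star s).
Proof.
split; [exact right_action_pair_ract|].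
split; [exact right_action_curve_ract|].
split; [exact left_action_curve_lact|].
split; [intros A s f; apply E_S_invariant|].
split.
{ intros A s H; split; [now apply E_G_invariant | now apply E_G_star_invariant]. }
split; [exact involution_dual|].
intros A s H; split; [now apply dual_curve_lact | now apply E_G_dual].
Qed.
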